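(* Let $A$ be an algebra in a (strict) monoidal category $\mathcal{C}$, and let $\mathcal{C}_A$ be the category of right $A$-modules in $\mathcal{C}$, regarded as a left $\mathcal{C}$-module category. Then $$Z(\mathcal{C}_A)=Z(A),$$ that is, the centre of the module category $\mathcal{C}_A$ and the full centre of the algebra $A$ coincide (one exists if and only if the other does, and they are then isomorphic as algebras in $\mathcal{Z}(\mathcal{C})$).
   Context: Monoidal categories are strict. Algebras are associative and unital, $(A,\mu,\iota)$. Monoidal centre: $\mathcal{Z}(\mathcal{C})$ is the category of pairs $(Z,z)$ with $Z\in\mathcal{C}$ and $z_X:Z\otimes X\to X\otimes Z$ natural isomorphisms with $z_I=1$ and $z_{X\otimes Y}=(X\otimes z_Y)(z_X\otimes Y)$; morphisms are morphisms in $\mathcal{C}$ compatible with half-braidings; $(Z,z)\otimes(W,w)=(Z\otimes W,z|w)$, $(z|w)_X=(z_X\otimes W)(Z\otimes w_X)$; braiding $c_{(X,x),(Y,y)}=x_Y$. Full centre $Z(A)$ of $A$: the terminal object of the category of pairs $(Z,\zeta)$ with $(Z,z)\in\mathcal{Z}(\mathcal{C})$ and $\zeta:Z\to A$ a morphism in $\mathcal{C}$ such that $\mu(\zeta\otimes A)=\mu(A\otimes\zeta)z_A$ (morphisms: morphisms in $\mathcal{Z}(\mathcal{C})$ commuting with the maps to $A$). It carries the unique algebra structure in $\mathcal{Z}(\mathcal{C})$ for which $Z(A)\to A$ is a homomorphism of algebras in $\mathcal{C}$. A right $A$-module is $(M,\nu)$ with $\nu:M\otimes A\to M$ such that $\nu(\nu\otimes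 A)=\nu(M\otimes\mu)$ and $\nu(M\otimes\iota)=1$; a homomorphism is $f:M\to N$ with $\nu_N(f\otimes A)=f\nu_M$. The action of $\mathcal{C}$ on $\mathcal{C}_A$ is $X*(M,\nu)=(X\otimes M,X\otimes\nu)$. A left $\mathcal{C}$-module category $\mathcal{M}$ is a category with a (strong) monoidal functor $\mathcal{C}\to\mathrm{End}(\mathcal{M})$, written $(X,M)\mapsto X*M$, with associativity isomorphisms $a_{X,Y,M}:X*(Y*M)\to(X\otimes Y)*M$. A $\mathcal{C}$-module functor $F$ has natural coherent isomorphisms $F_{X,M}:F(X*M)\to X*F(M)$. $\mathrm{End}_{\mathcal{C}}(\mathcal{M})$ is the monoidal category (under composition) of $\mathcal{C}$-module endofunctors and natural transformations compatible with the $\mathcal{C}$-module structures. Each $(Z,z)\in\mathcal{Z}(\mathcal{C})$ gives a $\mathcal{C}$-module endofunctor $M\mapsto Z*M$ with module structure $Z*(X*M)\to(Z\otimes X)*M\xrightarrow{z_X*M}(X\otimes Z)*M\to X*(Z*M)$; this defines a monoidal functor $E:\mathcal{Z}(\mathcal{C})\to\mathrm{End}_{\mathcal{C}}(\mathcal{M})$. The centre $Z(\mathcal{M})$ of $\mathcal{M}$ is the terminal object of the comma category $E\downarrow I$, $I$ the identity functor of $\mathcal{M}$: it is terminal among pairs $(Z,f)$ with $Z\in\mathcal{Z}(\mathcal{C})$ and $f_M:Z*M\to M$ natural in $M$ such that $f_{X*M}\,a_{Z,X,M}^{-1}=(X*f_M)\,a_{X,Z,M}^{-1}\,(z_X*M)$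 for all $X\in\mathcal{C}$, $M\in\mathcal{M}$. As a terminal object of the monoidal category $E\downarrow I$ (with $(Z,f)\otimes(W,g)$ given by $Z\otimes W$ and the composite $E(Z\otimes W)\cong E(Z)E(W)\xrightarrow{fg}I$), $Z(\mathcal{M})$ is an algebra via the unique morphisms to it, and so is an algebra in $\mathcal{Z}(\mathcal{C})$. *)

(* Defs.v *)
From Stdlib Require Import ssreflect ProofIrrelevance FunctionalExtensionality.

Set Implicit Arguments.
Unset Strict Implicit.
Unset Printing Implicit Defensive.

Declare Scope cat_scope.
Delimit Scope cat_scope with cat.
Local Open Scope cat_scope.

Record Category := MkCategory {
  Ob :> Type;
  Hom : Ob -> Ob -> Type;
  idm : forall X, Hom X X;
  comp : forall X Y Z, Hom Y Z -> Hom X Y -> Hom X Z;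
  comp_assoc : forall X Y Z W (h : Hom Z W) (g : Hom Y Z) (f : Hom X Y),
    comp h (comp g f) = comp (comp h g) f;
  comp_idl : forall X Y (f : Hom X Y), comp (idm Y) f = f;
  comp_idr : forall X Y (f : Hom X Y), comp f (idm X) = f }.

Arguments Hom {c} X Y.
Arguments idm {c} X.
Arguments comp {c X Y Z} g f.

Notation "g ∘ f" := (comp g f) (at level 40, left associativity) : cat_scope.

Record Iso (C : Category) (X Y : C) := MkIso {
  fwd :> Hom X Y;
  bwd : Hom Y X;
  bwd_fwd : bwd ∘ fwd = idm X;
  fwd_bwd : fwd ∘ bwd = idm Y }.

Definition is_iso (C : Category) (X Y : C) (f : Hom X Y) : Prop :=
  exists g : Hom Y X, g ∘ f = idm X /\ f ∘ g = idm Y.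

Record Terminal (D : Category) := MkTerminal {
  term_ob :> D;
  bang : forall X : D, Hom X term_ob;
  bang_unique : forall (X : D) (f : Hom X term_ob), f = bang X }.

(** The identity morphism, seen as a morphism between equal objects. *)
Definition eq_hom (C : Category) (X Y : C) (p : X = Y) : Hom X Y :=
  match p in _ = Y return Hom X Y with eq_refl => idm X end.

(** Associativity and unitality of the tensor product are equalities of
    objects; on morphisms they hold up to the identities [eq_hom], which only
    mediate between types. *)
Record StrictMonoidalCategory := MkStrictMonoidal {
  smc_cat :> Category;
  tens : smc_cat -> smc_cat -> smc_cat;
  unit : smc_cat;
  tensm : forall X X' Y Y' : smc_cat,
    Hom X X' -> Hom Y Y' -> Hom (tens X Y) (tens X' Y');
  tensm_id : forall X Y, tensm (idm X) (idm Y) = idm (tens X Y);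
  tensm_comp : forall X X' X'' Y Y' Y'' (f' : Hom X' X'') (f : Hom X X')
      (g' : Hom Y' Y'') (g : Hom Y Y'),
    tensm (f' ∘ f) (g' ∘ g) = tensm f' g' ∘ tensm f g;
  tens_assoc : forall X Y Z, tens (tens X Y) Z = tens X (tens Y Z);
  tens_unitl : forall X, tens unit X = X;
  tens_unitr : forall X, tens X unit = X;
  tensm_assoc : forall X X' Y Y' Z Z'
      (f : Hom X X') (g : Hom Y Y') (h : Hom Z Z'),
    eq_hom (tens_assoc X' Y' Z') ∘ tensm (tensm f g) h =
    tensm f (tensm g h) ∘ eq_hom (tens_assoc X Y Z);
  tensm_unitl : forall X X' (f : Hom X X'),
    eq_hom (tens_unitl X') ∘ tensm (idm unit) f = f ∘ eq_hom (tens_unitl X);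
  tensm_unitr : forall X X' (f : Hom X X'),
    eq_hom (tens_unitr X') ∘ tensm f (idm unit) = f ∘ eq_hom (tens_unitr X) }.

Arguments tens {s} X Y.
Arguments unit {s}.
Arguments tensm {s X X' Y Y'} f g.
Arguments tens_assoc {s} X Y Z.
Arguments tens_unitl {s} X.
Arguments tens_unitr {s} X.

Notation "X ⊗ Y" := (tens X Y) (at level 36, left associativity) : cat_scope.
Notation "f ⊠ g" := (tensm f g) (at level 36, left associativity) : cat_scope.

Definition asc (C : StrictMonoidalCategory) (X Y Z : C) :
  Hom (X ⊗ Y ⊗ Z) (X ⊗ (Y ⊗ Z)) := eq_hom (tens_assoc X Y Z).
Definition asc' (C : StrictMonoidalCategory) (X Y Z : C) :
  Hom (X ⊗ (Y ⊗ Z)) (X ⊗ Y ⊗ Z) := eq_hom (eq_sym (tens_assoc X Y Z)).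
Definition unl (C : StrictMonoidalCategory) (X : C) :
  Hom (unit ⊗ X) X := eq_hom (tens_unitl X).
Definition unl' (C : StrictMonoidalCategory) (X : C) :
  Hom X (unit ⊗ X) := eq_hom (eq_sym (tens_unitl X)).
Definition unr (C : StrictMonoidalCategory) (X : C) :
  Hom (X ⊗ unit) X := eq_hom (tens_unitr X).
Definition unr' (C : StrictMonoidalCategory) (X : C) :
  Hom X (X ⊗ unit) := eq_hom (eq_sym (tens_unitr X)).

Record Algebra (C : StrictMonoidalCategory) := MkAlgebra {
  alg_ob :> C;
  mul : Hom (alg_ob ⊗ alg_ob) alg_ob;
  one : Hom unit alg_ob;
  mul_assoc : mul ∘ (mul ⊠ idm alg_ob) =
              mul ∘ (idm alg_ob ⊠ mul) ∘ asc alg_ob alg_ob alg_ob;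
  mul_onel : mul ∘ (one ⊠ idm alg_ob) = unl alg_ob;
  mul_oner : mul ∘ (idm alg_ob ⊠ one) = unr alg_ob }.

Arguments mul {C} a.
Arguments one {C} a.

Definition is_alg_hom (C : StrictMonoidalCategory) (A B : Algebra C)
    (f : Hom A B) : Prop :=
  f ∘ mul A = mul B ∘ (f ⊠ f) /\ f ∘ one A = one B.

Definition alg_isomorphic (C : StrictMonoidalCategory) (A B : Algebra C) : Prop :=
  exists (f : Hom A B) (g : Hom B A),
    is_alg_hom f /\ is_alg_hom g /\ g ∘ f = idm A /\ f ∘ g = idm B.

Lemma uip (T : Type) (x y : T) (p q : x = y) : p = q.
Proof. exact: proof_irrelevance. Qed.

Section Heq.
Variable C : Category.

Inductive heq (X Y : C) (f : Hom X Y) :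
    forall X' Y' : C, Hom X' Y' -> Prop :=
  heq_refl : @heq X Y f X Y f.

Lemma heq_sym (X Y X' Y' : C) (f : Hom X Y) (g : Hom X' Y') :
  heq f g -> heq g f.
Proof. by case. Qed.

Lemma heq_trans (X Y X' Y' X'' Y'' : C) (f : Hom X Y) (g : Hom X' Y')
    (h : Hom X'' Y'') : heq f g -> heq g h -> heq f h.
Proof. by move=> H; case: X' Y' g / H. Qed.

Lemma heqE (X Y X' Y' : C) (f : Hom X Y) (g : Hom X' Y') (p : X = X')
    (q : Y = Y') : heq f g -> eq_hom q ∘ f = g ∘ eq_hom p.
Proof.
move=> H; case: X' Y' g / H p q => p q.
by rewrite (uip p eq_refl) (uip q eq_refl) /= comp_idl comp_idr.
Qed.

Lemma heq_eq (X Y : C) (f g : Hom X Y) : heq f g -> f = g.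
Proof. by move/(heqE eq_refl eq_refl) => /=; rewrite comp_idl comp_idr. Qed.

Lemma eq_heq (X Y : C) (f g : Hom X Y) : f = g -> heq f g.
Proof. by move=> ->. Qed.

Lemma heq_intro (X Y X' Y' : C) (f : Hom X Y) (g : Hom X' Y') (p : X = X')
    (q : Y = Y') : eq_hom q ∘ f = g ∘ eq_hom p -> heq f g.
Proof.
by case: X' / p g => g; case: Y' / q g => g /=; rewrite comp_idl comp_idr => ->.
Qed.

Lemma heq_dom (X Y X' Y' : C) (f : Hom X Y) (g : Hom X' Y') :
  heq f g -> X = X' /\ Y = Y'.
Proof. by case. Qed.

Lemma heq_comp (X Y Z X' Y' Z' : C) (f : Hom X Y) (f' : Hom X' Y')
    (g : Hom Y Z) (g' : Hom Y' Z') :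
  heq g g' -> heq f f' -> heq (g ∘ f) (g' ∘ f').
Proof.
move=> Hg Hf; have [eX eY] := heq_dom Hf; have [_ eZ] := heq_dom Hg.
subst X' Y' Z'; by rewrite (heq_eq Hg) (heq_eq Hf).
Qed.

Lemma heq_idm (X X' : C) : X = X' -> heq (idm X) (idm X').
Proof. by move=> ->. Qed.

Lemma heq_eq_hom (X Y X' : C) (p : X = Y) : X = X' -> heq (eq_hom p) (idm X').
Proof. by case: Y / p; case: X' /. Qed.

Lemma heq_eq_homs (X Y X' Y' : C) (p : X = Y) (q : X' = Y') :
  X = X' -> heq (eq_hom p) (eq_hom q).
Proof. by case: Y / p; case: Y' / q; case: X' /. Qed.

Lemma heq_castl (X Y Y' X1 Y1 : C) (p : Y = Y') (f : Hom X Y)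
    (g : Hom X1 Y1) : heq f g -> heq (eq_hom p ∘ f) g.
Proof. by case: Y' / p => /=; rewrite comp_idl. Qed.

Lemma heq_castr (X X' Y X1 Y1 : C) (p : X' = X) (f : Hom X Y)
    (g : Hom X1 Y1) : heq f g -> heq (f ∘ eq_hom p) g.
Proof. by case: X / p f => f /=; rewrite comp_idr. Qed.

Lemma eq_hom_comp (X Y Z : C) (p : X = Y) (q : Y = Z) :
  eq_hom q ∘ eq_hom p = eq_hom (eq_trans p q).
Proof. by case: Z / q; rewrite /= comp_idl. Qed.

Lemma eq_hom_id (X : C) (p : X = X) : eq_hom p = idm X.
Proof. by rewrite (uip p eq_refl). Qed.

Lemma eq_hom_irr (X Y : C) (p q : X = Y) : eq_hom p = eq_hom q.
Proof. by rewrite (uip p q). Qed.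

Definition ccomp (X Y Y' Z : C) (c : Y = Y') (g : Hom Y' Z) (f : Hom X Y) :
  Hom X Z := g ∘ eq_hom c ∘ f.

Lemma ccompE (X Y Z : C) (g : Hom Y Z) (f : Hom X Y) :
  g ∘ f = ccomp eq_refl g f.
Proof. by rewrite /ccomp /= comp_idr. Qed.

Lemma heq_ccomp (X Y1 Y2 Z X' Y1' Y2' Z' : C) (c : Y1 = Y2) (c' : Y1' = Y2')
    (f : Hom X Y1) (f' : Hom X' Y1') (g : Hom Y2 Z) (g' : Hom Y2' Z') :
  heq g g' -> heq f f' -> heq (ccomp c g f) (ccomp c' g' f').
Proof.
move=> Hg Hf; apply: heq_comp => //; apply: heq_castr.
exact: heq_trans (heq_sym (heq_castr c' (heq_sym Hg))).
Qed.

Lemma ccomp_assoc (X Y Y' Z Z' W : C) (c : Y = Y') (d : Z = Z')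
    (f : Hom X Y) (g : Hom Y' Z) (h : Hom Z' W) :
  ccomp d h (ccomp c g f) = ccomp c (ccomp d h g) f.
Proof. by rewrite /ccomp !comp_assoc. Qed.

End Heq.

Section HeqTens.
Variable C : StrictMonoidalCategory.

Lemma heq_tens (X1 Y1 X2 Y2 X1' Y1' X2' Y2' : C) (f : Hom X1 Y1)
    (f' : Hom X1' Y1') (g : Hom X2 Y2) (g' : Hom X2' Y2') :
  heq f f' -> heq g g' -> heq (f ⊠ g) (f' ⊠ g').
Proof.
by move=> Hf Hg; case: X1' Y1' f' / Hf; case: X2' Y2' g' / Hg.
Qed.

Lemma heq_assoc (X1 Y1 X2 Y2 X3 Y3 : C) (f : Hom X1 Y1) (g : Hom X2 Y2)
    (h : Hom X3 Y3) : heq (f ⊠ g ⊠ h) (f ⊠ (g ⊠ h)).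
Proof. exact: heq_intro (tensm_assoc f g h). Qed.

Lemma heq_unitl (X Y : C) (f : Hom X Y) : heq (idm unit ⊠ f) f.
Proof. exact: heq_intro (tensm_unitl f). Qed.

Lemma heq_unitr (X Y : C) (f : Hom X Y) : heq (f ⊠ idm unit) f.
Proof. exact: heq_intro (tensm_unitr f). Qed.

Lemma tensm_compl (X Y Z W : C) (g : Hom Y Z) (f : Hom X Y) :
  (g ∘ f) ⊠ idm W = (g ⊠ idm W) ∘ (f ⊠ idm W).
Proof. by rewrite -tensm_comp comp_idl. Qed.

Lemma tensm_compr (X Y Z W : C) (g : Hom Y Z) (f : Hom X Y) :
  idm W ⊠ (g ∘ f) = (idm W ⊠ g) ∘ (idm W ⊠ f).
Proof. by rewrite -tensm_comp comp_idl. Qed.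

Lemma tensm_split (X Y X' Y' : C) (f : Hom X Y) (g : Hom X' Y') :
  f ⊠ g = (f ⊠ idm Y') ∘ (idm X ⊠ g).
Proof. by rewrite -tensm_comp comp_idl comp_idr. Qed.

Lemma tensm_split' (X Y X' Y' : C) (f : Hom X Y) (g : Hom X' Y') :
  f ⊠ g = (idm Y ⊠ g) ∘ (f ⊠ idm X').
Proof. by rewrite -tensm_comp comp_idl comp_idr. Qed.

Lemma tensm_eq_homl (X Y Z : C) (p : X = Y) :
  eq_hom p ⊠ idm Z = eq_hom (f_equal (fun T => T ⊗ Z) p).
Proof. by case: Y / p; rewrite /= tensm_id. Qed.

Lemma tensm_eq_homr (X Y Z : C) (p : X = Y) :
  idm Z ⊠ eq_hom p = eq_hom (f_equal (tens Z) p).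
Proof. by case: Y / p; rewrite /= tensm_id. Qed.

Lemma ccomp_tensl (X Y Y' Z W : C) (c : Y = Y') (g : Hom Y' Z) (f : Hom X Y) :
  ccomp c g f ⊠ idm W =
  ccomp (f_equal (fun T => T ⊗ W) c) (g ⊠ idm W) (f ⊠ idm W).
Proof. by rewrite /ccomp !tensm_compl tensm_eq_homl. Qed.

Lemma ccomp_tensr (X Y Y' Z W : C) (c : Y = Y') (g : Hom Y' Z) (f : Hom X Y) :
  idm W ⊠ ccomp c g f =
  ccomp (f_equal (tens W) c) (idm W ⊠ g) (idm W ⊠ f).
Proof. by rewrite /ccomp !tensm_compr tensm_eq_homr. Qed.

Lemma asc_nat (X X' Y Y' Z Z' : C) (f : Hom X X') (g : Hom Y Y')
    (h : Hom Z Z') :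
  asc X' Y' Z' ∘ (f ⊠ g ⊠ h) = (f ⊠ (g ⊠ h)) ∘ asc X Y Z.
Proof. exact: tensm_assoc. Qed.

Lemma asc_asc' (X Y Z : C) : asc X Y Z ∘ asc' X Y Z = idm (X ⊗ (Y ⊗ Z)).
Proof. by rewrite /asc /asc' eq_hom_comp eq_hom_id. Qed.

Lemma asc'_asc (X Y Z : C) : asc' X Y Z ∘ asc X Y Z = idm (X ⊗ Y ⊗ Z).
Proof. by rewrite /asc /asc' eq_hom_comp eq_hom_id. Qed.

Lemma asc'_nat (X X' Y Y' Z Z' : C) (f : Hom X X') (g : Hom Y Y')
    (h : Hom Z Z') :
  asc' X' Y' Z' ∘ (f ⊠ (g ⊠ h)) = (f ⊠ g ⊠ h) ∘ asc' X Y Z.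
Proof.
rewrite -[LHS]comp_idr -(asc_asc' X Y Z) comp_assoc -(comp_assoc (asc' _ _ _)).
by rewrite -asc_nat comp_assoc asc'_asc comp_idl.
Qed.

End HeqTens.

Section IsIso.
Variable C : Category.

Lemma is_iso_comp (X Y Z : C) (g : Hom Y Z) (f : Hom X Y) :
  is_iso g -> is_iso f -> is_iso (g ∘ f).
Proof.
move=> [g' [g1 g2]] [f' [f1 f2]]; exists (f' ∘ g'); split.
- by rewrite comp_assoc -(comp_assoc f') g1 comp_idr f1.
- by rewrite comp_assoc -(comp_assoc g) f2 comp_idr g2.
Qed.

Lemma is_iso_eq_hom (X Y : C) (p : X = Y) : is_iso (eq_hom p).
Proof. by exists (eq_hom (eq_sym p)); rewrite !eq_hom_comp !eq_hom_id. Qed.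

Lemma is_iso_fwd (X Y : C) (i : Iso X Y) : is_iso (fwd i).
Proof. by exists (bwd i); rewrite bwd_fwd fwd_bwd. Qed.

Lemma is_iso_bwd (X Y : C) (i : Iso X Y) : is_iso (bwd i).
Proof. by exists (fwd i); rewrite bwd_fwd fwd_bwd. Qed.

Lemma is_iso_idm (X : C) : is_iso (idm X).
Proof. exact: (is_iso_eq_hom eq_refl). Qed.

End IsIso.

Lemma is_iso_tensm (C : StrictMonoidalCategory) (X Y X' Y' : C)
    (f : Hom X Y) (g : Hom X' Y') : is_iso f -> is_iso g -> is_iso (f ⊠ g).
Proof.
move=> [f' [f1 f2]] [g' [g1 g2]]; exists (f' ⊠ g').
by rewrite -!tensm_comp f1 f2 g1 g2 !tensm_id.
Qed.

Section Centre.
Variable C : StrictMonoidalCategory.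

Record centre_ob := MkCentreOb {
  cob :> C;
  hbr : forall X : C, Hom (cob ⊗ X) (X ⊗ cob);
  hbr_iso : forall X, is_iso (hbr X);
  hbr_nat : forall (X Y : C) (f : Hom X Y),
    hbr Y ∘ (idm cob ⊠ f) = (f ⊠ idm cob) ∘ hbr X;
  hbr_unit : hbr unit = unl' cob ∘ unr cob;
  hbr_tens : forall X Y : C,
    hbr (X ⊗ Y) =
    asc' X Y cob ∘ (idm X ⊠ hbr Y) ∘ asc X cob Y ∘ (hbr X ⊠ idm Y)
      ∘ asc' cob X Y }.

Record centre_hom (Z W : centre_ob) := MkCentreHom {
  chom :> Hom (cob Z) (cob W);
  chom_hbr : forall X : C,
    hbr W X ∘ (chom ⊠ idm X) = (idm X ⊠ chom) ∘ hbr Z X }.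

Lemma centre_hom_eq (Z W : centre_ob) (f g : centre_hom Z W) :
  chom f = chom g -> f = g.
Proof.
case: f g => f Hf [g Hg] /= E; subst g; f_equal; exact: proof_irrelevance.
Qed.

Lemma centre_ob_eq (Z W : centre_ob) (p : cob Z = cob W) :
  (forall X, heq (hbr Z X) (hbr W X)) -> Z = W.
Proof.
case: Z W p => Z z z1 z2 z3 z4 [W w w1 w2 w3 w4] /= p; subst W => H.
have E : z = w by apply: functional_extensionality_dep => X; exact: heq_eq.
subst w; f_equal; exact: proof_irrelevance.
Qed.

Program Definition centre_idm (Z : centre_ob) : centre_hom Z Z :=
  @MkCentreHom Z Z (idm (cob Z)) _.
Next Obligation.
by move=> Z X; rewrite !tensm_id comp_idl comp_idr.
Qed.

Program Definition centre_comp (Z W V : centre_ob) (g : centre_hom W V)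
    (f : centre_hom Z W) : centre_hom Z V := @MkCentreHom Z V (g ∘ f) _.
Next Obligation.
move=> Z W V g f X.
by rewrite tensm_compl tensm_compr comp_assoc chom_hbr -comp_assoc chom_hbr
  comp_assoc.
Qed.

Program Definition centre_cat : Category :=
  @MkCategory centre_ob centre_hom centre_idm centre_comp _ _ _.
Next Obligation. by move=> *; apply: centre_hom_eq; exact: comp_assoc. Qed.
Next Obligation. by move=> *; apply: centre_hom_eq; exact: comp_idl. Qed.
Next Obligation. by move=> *; apply: centre_hom_eq; exact: comp_idr. Qed.

Lemma chom_eq_hom (Z W : centre_cat) (p : Z = W) (q : cob Z = cob W) :
  chom (eq_hom p) = eq_hom q.
Proof. by case: W / p q => q; rewrite (uip q eq_refl). Qed.

Definition hbr_prod (Z W : centre_ob) (X : C) :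
    Hom (cob Z ⊗ cob W ⊗ X) (X ⊗ (cob Z ⊗ cob W)) :=
  asc X Z W ∘ (hbr Z X ⊠ idm (cob W)) ∘ asc' Z X W ∘ (idm (cob Z) ⊠ hbr W X)
    ∘ asc Z W X.

Lemma hbr_prod_heq (Z W : centre_ob) (X : C) :
  heq (hbr_prod Z W X)
    (ccomp (eq_sym (tens_assoc (cob Z) X (cob W)))
       (hbr Z X ⊠ idm (cob W)) (idm (cob Z) ⊠ hbr W X)).
Proof.
rewrite /hbr_prod /ccomp; apply: heq_castr; rewrite -!comp_assoc.
exact: heq_castl.
Qed.

Lemma hbr_tens_heq (Z : centre_ob) (X Y : C) :
  heq (hbr Z (X ⊗ Y))
    (ccomp (tens_assoc X (cob Z) Y) (idm X ⊠ hbr Z Y) (hbr Z X ⊠ idm Y)).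
Proof.
rewrite hbr_tens /ccomp; apply: heq_castr; rewrite -!comp_assoc.
exact: heq_castl.
Qed.

Program Definition centre_tens (Z W : centre_ob) : centre_ob :=
  @MkCentreOb (cob Z ⊗ cob W) (hbr_prod Z W) _ _ _ _.
Next Obligation.
move=> Z W X; rewrite /hbr_prod.
do !apply: is_iso_comp; try exact: is_iso_eq_hom;
  apply: is_iso_tensm; try exact: is_iso_idm; exact: hbr_iso.
Qed.
Next Obligation.
move=> Z W X Y f; rewrite /hbr_prod -tensm_id.
rewrite -[LHS]comp_assoc asc_nat comp_assoc.
rewrite -(comp_assoc _ (_ ⊠ hbr W X)) -(comp_assoc _ (_ ⊠ hbr W Y)) -tensm_compr.
rewrite hbr_nat tensm_compr !comp_assoc -(comp_assoc _ (asc' _ _ _)) asc'_nat.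
rewrite !comp_assoc -(comp_assoc _ (_ ⊠ _) (_ ⊠ _ ⊠ _)) -tensm_compl hbr_nat.
by rewrite tensm_compl !comp_assoc asc_nat tensm_id.
Qed.
Next Obligation.
move=> Z W; apply: heq_eq; apply: (heq_trans (hbr_prod_heq Z W unit)).
rewrite /ccomp !hbr_unit /unl' /unr !eq_hom_comp tensm_eq_homl tensm_eq_homr.
by rewrite !eq_hom_comp; apply: heq_eq_homs; rewrite tens_assoc.
Qed.
Next Obligation.
move=> Z W X Y; apply: heq_eq.
pose A1 := idm X ⊠ (hbr Z Y ⊠ idm (cob W)).
pose A4 := idm (cob Z) ⊠ (hbr W X ⊠ idm Y).
have c1 : X ⊗ cob Z ⊗ (Y ⊗ cob W) = X ⊗ (cob Z ⊗ Y ⊗ cob W)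
  by rewrite !tens_assoc.
have c2 : X ⊗ cob Z ⊗ (cob W ⊗ Y) = X ⊗ cob Z ⊗ (cob W ⊗ Y) by [].
have c3 : cob Z ⊗ (X ⊗ cob W ⊗ Y) = cob Z ⊗ X ⊗ (cob W ⊗ Y)
  by rewrite !tens_assoc.
have c4 : X ⊗ cob Z ⊗ (Y ⊗ cob W) = X ⊗ (cob Z ⊗ Y ⊗ cob W)
  by rewrite !tens_assoc.
have L1 : heq (hbr Z (X ⊗ Y) ⊠ idm (cob W))
    (ccomp c1 A1 (hbr Z X ⊠ idm (Y ⊗ cob W))).
  apply: (heq_trans (heq_tens (hbr_tens_heq Z X Y) (heq_refl _))).
  rewrite ccomp_tensl; apply: heq_ccomp; first exact: heq_assoc.
  by rewrite -tensm_id; exact: heq_assoc.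
have L2 : heq (idm (cob Z) ⊠ hbr W (X ⊗ Y))
    (ccomp c3 (idm (cob Z ⊗ X) ⊠ hbr W Y) A4).
  apply: (heq_trans (heq_tens (heq_refl _) (hbr_tens_heq W X Y))).
  rewrite ccomp_tensr; apply: heq_ccomp => //.
  by rewrite -tensm_id; apply: heq_sym; exact: heq_assoc.
have R1 : heq (idm X ⊠ hbr_prod Z W Y)
    (ccomp c4 A1 (idm (X ⊗ cob Z) ⊠ hbr W Y)).
  apply: (heq_trans (heq_tens (heq_refl _) (hbr_prod_heq Z W Y))).
  rewrite ccomp_tensr; apply: heq_ccomp => //.
  by rewrite -tensm_id; apply: heq_sym; exact: heq_assoc.
have R2 : heq (hbr_prod Z W X ⊠ idm Y)
    (ccomp c3 (hbr Z X ⊠ idm (cob W ⊗ Y)) A4).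
  apply: (heq_trans (heq_tens (hbr_prod_heq Z W X) (heq_refl _))).
  rewrite ccomp_tensl; apply: heq_ccomp; last exact: heq_assoc.
  by rewrite -tensm_id; exact: heq_assoc.
apply: (heq_trans (hbr_prod_heq Z W _)).
apply: (heq_trans (heq_ccomp _ eq_refl L1 L2)).
apply: heq_sym; apply: heq_castr; rewrite -!comp_assoc; apply: heq_castl.
rewrite comp_assoc; apply: (heq_trans (heq_ccomp _ eq_refl R1 R2)).
apply: eq_heq; rewrite -!ccompE (uip c4 c1) /ccomp !comp_assoc.
rewrite -(comp_assoc _ (idm _ ⊠ hbr W Y)) -tensm_split'.
by rewrite -[in RHS](comp_assoc _ (hbr Z X ⊠ _)) -tensm_split.
Qed.

Program Definition centre_unit : centre_ob :=
  @MkCentreOb unit (fun X => unr' X ∘ unl X) _ _ _ _.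
Next Obligation. by move=> X; apply: is_iso_comp; exact: is_iso_eq_hom. Qed.
Next Obligation.
move=> X Y f; apply: heq_eq; rewrite /unr' /unl -comp_assoc.
apply: heq_castl; rewrite comp_assoc; apply: heq_castl.
apply: heq_sym; apply: heq_castr; apply: heq_castr.
exact: (heq_trans (heq_unitr f) (heq_sym (heq_unitl f))).
Qed.
Next Obligation.
rewrite /unr' /unl' /unl /unr !eq_hom_comp; exact: eq_hom_irr.
Qed.
Next Obligation.
move=> X Y; rewrite /unr' /unl /asc /asc' !eq_hom_comp tensm_eq_homl.
rewrite tensm_eq_homr !eq_hom_comp; exact: eq_hom_irr.
Qed.

Program Definition centre_tensm (Z Z' W W' : centre_ob) (f : centre_hom Z Z')
    (g : centre_hom W W') : centre_hom (centre_tens Z W) (centre_tens Z' W') :=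
  @MkCentreHom (centre_tens Z W) (centre_tens Z' W') (f ⊠ g) _.
Next Obligation.
move=> Z Z' W W' f g X; rewrite /= /hbr_prod.
rewrite -comp_assoc asc_nat comp_assoc -(comp_assoc _ _ (f ⊠ (g ⊠ _))).
rewrite -tensm_comp comp_idl chom_hbr.
rewrite -[X in X ⊠ (_ ∘ _)]comp_idr tensm_comp comp_assoc.
rewrite -(comp_assoc _ (asc' _ _ _)) asc'_nat comp_assoc.
rewrite -(comp_assoc _ _ (f ⊠ _ ⊠ _)) -tensm_comp comp_idl chom_hbr.
rewrite -[X in _ ⊠ X]comp_idr tensm_comp !comp_assoc asc_nat.
done.
Qed.

Program Definition centre : StrictMonoidalCategory :=
  @MkStrictMonoidal centre_cat centre_tens centre_unit centre_tensm
    _ _ _ _ _ _ _ _.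
Next Obligation. by move=> Z W; apply: centre_hom_eq; exact: tensm_id. Qed.
Next Obligation. by move=> *; apply: centre_hom_eq; exact: tensm_comp. Qed.
Next Obligation.
move=> Z W V; apply: centre_ob_eq => [|X]; first exact: tens_assoc.
pose B1 := hbr Z X ⊠ idm (cob W ⊗ cob V).
pose B2 := idm (cob Z) ⊠ (hbr W X ⊠ idm (cob V)).
pose B3 := idm (cob Z) ⊠ (idm (cob W) ⊠ hbr V X).
have c1 : cob Z ⊗ (X ⊗ cob W ⊗ cob V) = cob Z ⊗ X ⊗ (cob W ⊗ cob V)
  by rewrite !tens_assoc.
have c2 : cob Z ⊗ (cob W ⊗ (X ⊗ cob V)) = cob Z ⊗ (cob W ⊗ X ⊗ cob V)
  by rewrite !tens_assoc.
apply: (@heq_trans _ _ _ _ _ _ _ _ (ccomp c2 (ccomp c1 B1 B2) B3)).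
- apply: (heq_trans (hbr_prod_heq _ V X)); apply: heq_ccomp; last first.
    by rewrite /= -tensm_id; exact: heq_assoc.
  apply: (heq_trans (heq_tens (hbr_prod_heq Z W X) (heq_refl _))).
  rewrite ccomp_tensl; apply: heq_ccomp; last exact: heq_assoc.
  by rewrite /B1 -tensm_id; exact: heq_assoc.
- rewrite -ccomp_assoc; apply: heq_sym.
  apply: (heq_trans (hbr_prod_heq Z _ X)); apply: heq_ccomp => //.
  apply: (heq_trans (heq_tens (heq_refl _) (hbr_prod_heq W V X))).
  by rewrite ccomp_tensr; apply: heq_ccomp.
Qed.
Next Obligation.
move=> Z; apply: centre_ob_eq => [|X]; first exact: tens_unitl.
apply: (heq_trans (hbr_prod_heq _ Z X)).
rewrite /ccomp /= /unr' /unl eq_hom_comp tensm_eq_homl eq_hom_comp.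
by apply: heq_castl; exact: heq_unitl.
Qed.
Next Obligation.
move=> Z; apply: centre_ob_eq => [|X]; first exact: tens_unitr.
apply: (heq_trans (hbr_prod_heq Z _ X)).
rewrite /ccomp /= /unr' /unl eq_hom_comp tensm_eq_homr -comp_assoc eq_hom_comp.
by apply: heq_castr; exact: heq_unitr.
Qed.
Next Obligation.
move=> *; apply: centre_hom_eq.
by rewrite /= !(@chom_eq_hom (centre_tens (centre_tens _ _) _)
  (centre_tens _ (centre_tens _ _)) _ (tens_assoc _ _ _)); exact: tensm_assoc.
Qed.
Next Obligation.
move=> *; apply: centre_hom_eq.
by rewrite /= !(@chom_eq_hom (centre_tens centre_unit _) _ _
  (tens_unitl _)); exact: tensm_unitl.
Qed.
Next Obligation.
move=> *; apply: centre_hom_eq.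
by rewrite /= !(@chom_eq_hom (centre_tens _ centre_unit) _ _
  (tens_unitr _)); exact: tensm_unitr.
Qed.

End Centre.

Section TerminalAlgebra.
Variables (D : StrictMonoidalCategory) (T : Terminal D).

Lemma terminal_eq (X : D) (f g : Hom X T) : f = g.
Proof. by rewrite (bang_unique f) (bang_unique g). Qed.

Definition terminal_algebra : Algebra D :=
  @MkAlgebra D T (bang T (T ⊗ T)) (bang T unit)
    (terminal_eq _ _) (terminal_eq _ _) (terminal_eq _ _).

End TerminalAlgebra.

Section FullCentre.
Variables (C : StrictMonoidalCategory) (A : Algebra C).

Record fc_ob := MkFcOb {
  fc_centre : centre C;
  fc_map : Hom (cob fc_centre) A;
  fc_comm : mul A ∘ (fc_map ⊠ idm A) =
            mul A ∘ (idm A ⊠ fc_map) ∘ hbr fc_centre A }.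

Record fc_hom (Z W : fc_ob) := MkFcHom {
  fc_chom : Hom (fc_centre Z) (fc_centre W);
  fc_chom_map : fc_map W ∘ chom fc_chom = fc_map Z }.

Lemma fc_hom_eq (Z W : fc_ob) (f g : fc_hom Z W) :
  fc_chom f = fc_chom g -> f = g.
Proof.
case: f g => f Hf [g Hg] /= E; subst g; f_equal; exact: proof_irrelevance.
Qed.

Lemma fc_ob_eq (Z W : fc_ob) :
  fc_centre Z = fc_centre W -> heq (fc_map Z) (fc_map W) -> Z = W.
Proof.
case: Z W => Z z Hz [W w Hw] /= p; subst W => /heq_eq E; subst w.
f_equal; exact: proof_irrelevance.
Qed.

Program Definition fc_idm (Z : fc_ob) : fc_hom Z Z :=
  @MkFcHom Z Z (idm (fc_centre Z)) _.
Next Obligation. by move=> Z; exact: comp_idr. Qed.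

Program Definition fc_comp (Z W V : fc_ob) (g : fc_hom W V) (f : fc_hom Z W) :
  fc_hom Z V := @MkFcHom Z V (fc_chom g ∘ fc_chom f) _.
Next Obligation.
by move=> Z W V g f; rewrite /= comp_assoc !fc_chom_map.
Qed.

Program Definition fc_cat : Category :=
  @MkCategory fc_ob fc_hom fc_idm fc_comp _ _ _.
Next Obligation. by move=> *; apply: fc_hom_eq; exact: comp_assoc. Qed.
Next Obligation. by move=> *; apply: fc_hom_eq; exact: comp_idl. Qed.
Next Obligation. by move=> *; apply: fc_hom_eq; exact: comp_idr. Qed.

Definition FullCentre := Terminal fc_cat.

Lemma mul_asc' :
  mul A ∘ (idm A ⊠ mul A) = mul A ∘ (mul A ⊠ idm A) ∘ asc' A A A.
Proof. by rewrite mul_assoc -comp_assoc asc_asc' comp_idr. Qed.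

(* The monoidal structure on [fc_cat] that produces the multiplication of the
   full centre: the structure map of a tensor product is [mul (f ⊠ g)]. *)
Program Definition fc_tens (Z W : fc_ob) : fc_ob :=
  @MkFcOb (fc_centre Z ⊗ fc_centre W) (mul A ∘ (fc_map Z ⊠ fc_map W)) _.
Next Obligation.
move=> Z W /=; rewrite /hbr_prod.
rewrite tensm_compl comp_assoc mul_assoc -comp_assoc asc_nat comp_assoc.
rewrite -(comp_assoc _ _ (_ ⊠ (_ ⊠ _))) -tensm_comp comp_idl fc_comm.
set z := hbr (fc_centre Z) A; set w := hbr (fc_centre W) A.
set f := fc_map Z; set g := fc_map W.
pose k := (mul A ∘ (idm A ⊠ f) ∘ z) ⊠ g.
have L : mul A ∘ (f ⊠ (mul A ∘ (idm A ⊠ g) ∘ w)) =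
    mul A ∘ k ∘ asc' _ _ _ ∘ (idm (cob (fc_centre Z)) ⊠ w).
  rewrite -comp_assoc -{1}[f]comp_idl tensm_comp comp_assoc.
  rewrite -{1}[f]comp_idr tensm_comp comp_assoc mul_asc'.
  rewrite -(comp_assoc _ (asc' _ _ _)) asc'_nat !comp_assoc.
  by rewrite -(comp_assoc _ (mul A ⊠ _)) -tensm_comp fc_comm comp_idl.
have R : mul A ∘ (idm A ⊠ (mul A ∘ (f ⊠ g))) ∘ asc _ _ _ ∘
    (z ⊠ idm (cob (fc_centre W))) = mul A ∘ k.
  rewrite tensm_compr comp_assoc -(comp_assoc _ _ (asc _ _ _)) -asc_nat.
  rewrite comp_assoc -mul_assoc -!comp_assoc -!tensm_comp.
  by rewrite comp_idl comp_idr !comp_assoc.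
by rewrite L !comp_assoc R.
Qed.

Program Definition fc_unit : fc_ob := @MkFcOb unit (one A) _.
Next Obligation.
rewrite mul_onel mul_oner /= /unr /unr' /unl !eq_hom_comp; exact: eq_hom_irr.
Qed.

Program Definition fc_tensm (Z Z' W W' : fc_ob) (f : fc_hom Z Z')
    (g : fc_hom W W') : fc_hom (fc_tens Z W) (fc_tens Z' W') :=
  @MkFcHom (fc_tens Z W) (fc_tens Z' W') (fc_chom f ⊠ fc_chom g) _.
Next Obligation.
by move=> Z Z' W W' f g; rewrite /= -comp_assoc -tensm_comp !fc_chom_map.
Qed.

Lemma fc_chom_eq_hom (Z W : fc_cat) (p : Z = W)
    (q : fc_centre Z = fc_centre W) : fc_chom (eq_hom p) = eq_hom q.
Proof. by case: W / p q => q; rewrite (uip q eq_refl). Qed.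

Program Definition fc_smc : StrictMonoidalCategory :=
  @MkStrictMonoidal fc_cat fc_tens fc_unit fc_tensm _ _ _ _ _ _ _ _.
Next Obligation. by move=> *; apply: fc_hom_eq; exact: tensm_id. Qed.
Next Obligation. by move=> *; apply: fc_hom_eq; exact: tensm_comp. Qed.
Next Obligation.
move=> Z W V; apply: fc_ob_eq; first exact: tens_assoc.
rewrite /= -[fc_map V in X in heq X _]comp_idl.
rewrite -[fc_map Z in X in heq _ X]comp_idl !tensm_comp !comp_assoc mul_assoc.
by rewrite -(comp_assoc _ (asc _ _ _)) asc_nat comp_assoc; apply: heq_castr.
Qed.
Next Obligation.
move=> Z; apply: fc_ob_eq; first exact: tens_unitl.
rewrite /= -[fc_map Z in X in heq X _]comp_idl -[one A]comp_idr.
rewrite tensm_comp comp_assoc mul_onel; apply: heq_castl.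
exact: heq_unitl.
Qed.
Next Obligation.
move=> Z; apply: fc_ob_eq; first exact: tens_unitr.
rewrite /= -[fc_map Z in X in heq X _]comp_idl -[one A]comp_idr.
rewrite tensm_comp comp_assoc mul_oner; apply: heq_castl.
exact: heq_unitr.
Qed.
Next Obligation.
move=> X X' Y Y' Z Z' f g h; apply: fc_hom_eq.
by rewrite /= !(@fc_chom_eq_hom (fc_tens (fc_tens _ _) _)
  (fc_tens _ (fc_tens _ _)) _ (tens_assoc _ _ _)); exact: (tensm_assoc (fc_chom f) (fc_chom g) (fc_chom h)).
Qed.
Next Obligation.
move=> X X' f; apply: fc_hom_eq.
by rewrite /= !(@fc_chom_eq_hom (fc_tens fc_unit _) _ _
  (tens_unitl _)); exact: (tensm_unitl (fc_chom f)).
Qed.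
Next Obligation.
move=> X X' f; apply: fc_hom_eq.
by rewrite /= !(@fc_chom_eq_hom (fc_tens _ fc_unit) _ _
  (tens_unitr _)); exact: (tensm_unitr (fc_chom f)).
Qed.

Program Definition fc_forget (B : Algebra fc_smc) : Algebra (centre C) :=
  @MkAlgebra (centre C) (fc_centre (alg_ob B)) (fc_chom (mul B)) (fc_chom (one B)) _ _ _.
Next Obligation.
move=> B; apply: (eq_trans (f_equal (@fc_chom _ _) (mul_assoc B))).
pose Z := fc_centre (alg_ob B); pose m : Hom (Z ⊗ Z) Z := fc_chom (mul B).
apply: (f_equal (comp (m ∘ (idm Z ⊠ m)))).
exact: (fc_chom_eq_hom (@tens_assoc fc_smc B B B) (@tens_assoc (centre C) Z Z Z)).
Qed.
Next Obligation.
move=> B; apply: (eq_trans (f_equal (@fc_chom _ _) (mul_onel B))).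
exact: (fc_chom_eq_hom (@tens_unitl fc_smc B)
  (@tens_unitl (centre C) (fc_centre (alg_ob B)))).
Qed.
Next Obligation.
move=> B; apply: (eq_trans (f_equal (@fc_chom _ _) (mul_oner B))).
exact: (fc_chom_eq_hom (@tens_unitr fc_smc B)
  (@tens_unitr (centre C) (fc_centre (alg_ob B)))).
Qed.

(** By [full_centre_algebra_hom] and [full_centre_algebra_unique], this is the
    unique algebra structure in the monoidal centre for which the structure map
    to [A] is a homomorphism of algebras in [C]. *)
Definition full_centre_algebra (T : FullCentre) : Algebra (centre C) :=
  fc_forget (@terminal_algebra fc_smc T).

End FullCentre.

Program Definition centre_forget (C : StrictMonoidalCategory)
    (B : Algebra (centre C)) : Algebra C :=
  @MkAlgebra C (cob (alg_ob B)) (chom (mul B)) (chom (one B)) _ _ _.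
Next Obligation.
move=> C B; apply: (eq_trans (f_equal (@chom _ _ _) (mul_assoc B))).
pose Z := cob (alg_ob B); pose m : Hom (Z ⊗ Z) Z := chom (mul B).
apply: (f_equal (comp (m ∘ (idm Z ⊠ m)))).
exact: (@chom_eq_hom C _ _ (@tens_assoc (centre C) B B B) (tens_assoc Z Z Z)).
Qed.
Next Obligation.
move=> C B; apply: (eq_trans (f_equal (@chom _ _ _) (mul_onel B))).
exact: (@chom_eq_hom C _ _ (@tens_unitl (centre C) B)
  (@tens_unitl C (cob (alg_ob B)))).
Qed.
Next Obligation.
move=> C B; apply: (eq_trans (f_equal (@chom _ _ _) (mul_oner B))).
exact: (@chom_eq_hom C _ _ (@tens_unitr (centre C) B)
  (@tens_unitr C (cob (alg_ob B)))).
Qed.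

Lemma full_centre_algebra_hom (C : StrictMonoidalCategory) (A : Algebra C)
    (T : FullCentre A) :
  @is_alg_hom C (centre_forget (full_centre_algebra T)) A (fc_map (term_ob T)).
Proof.
split; first exact: (fc_chom_map (bang T (@tens (fc_smc A) T T))).
exact: (fc_chom_map (bang T (@unit (fc_smc A)))).
Qed.

Lemma full_centre_algebra_unique (C : StrictMonoidalCategory) (A : Algebra C)
    (T : FullCentre A) (m : Hom (fc_centre (term_ob T) ⊗ fc_centre (term_ob T)) (fc_centre (term_ob T)))
    (e : Hom unit (fc_centre (term_ob T)))
    (a : m ∘ (m ⊠ idm (fc_centre (term_ob T))) = m ∘ (idm (fc_centre (term_ob T)) ⊠ m) ∘ asc _ _ _)
    (l : m ∘ (e ⊠ idm (fc_centre (term_ob T))) = unl (fc_centre (term_ob T)))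
    (r : m ∘ (idm (fc_centre (term_ob T)) ⊠ e) = unr (fc_centre (term_ob T))) :
  @is_alg_hom C (centre_forget (MkAlgebra a l r)) A (fc_map (term_ob T)) ->
  MkAlgebra a l r = full_centre_algebra T.
Proof.
move=> [/= Hm He].
pose m' := @MkFcHom C A (fc_tens (term_ob T) (term_ob T)) (term_ob T) m Hm.
pose e' := @MkFcHom C A (fc_unit A) (term_ob T) e He.
have Em : m = mul (full_centre_algebra T) :=
  f_equal (@fc_chom _ _ _ _) (bang_unique (t := T) m').
have Ee : e = one (full_centre_algebra T) :=
  f_equal (@fc_chom _ _ _ _) (bang_unique (t := T) e').
rewrite /full_centre_algebra /fc_forget; clear m' e' Hm He; subst m e.
f_equal; exact: proof_irrelevance.
Qed.

(** A strong monoidal functor from [C] to the endofunctors of [mc_cat], with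
    its coherence isomorphisms, written out. *)
Record ModuleCategory (C : StrictMonoidalCategory) := MkModuleCategory {
  mc_cat :> Category;
  act : C -> mc_cat -> mc_cat;
  actm : forall (X X' : C) (M M' : mc_cat),
    Hom X X' -> Hom M M' -> Hom (act X M) (act X' M');
  actm_id : forall X M, actm (idm X) (idm M) = idm (act X M);
  actm_comp : forall (X X' X'' : C) (M M' M'' : mc_cat) (f' : Hom X' X'')
      (f : Hom X X') (g' : Hom M' M'') (g : Hom M M'),
    actm (f' ∘ f) (g' ∘ g) = actm f' g' ∘ actm f g;
  act_assoc : forall (X Y : C) (M : mc_cat),
    Iso (act X (act Y M)) (act (X ⊗ Y) M);
  act_unit : forall M : mc_cat, Iso (act unit M) M;
  act_assoc_nat : forall (X X' Y Y' : C) (M M' : mc_cat) (f : Hom X X')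
      (g : Hom Y Y') (h : Hom M M'),
    act_assoc X' Y' M' ∘ actm f (actm g h) =
    actm (f ⊠ g) h ∘ act_assoc X Y M;
  act_unit_nat : forall (M M' : mc_cat) (h : Hom M M'),
    act_unit M' ∘ actm (idm unit) h = h ∘ act_unit M;
  act_assoc_coh : forall (X Y Z : C) (M : mc_cat),
    actm (asc X Y Z) (idm M) ∘ act_assoc (X ⊗ Y) Z M
      ∘ act_assoc X Y (act Z M) =
    act_assoc X (Y ⊗ Z) M ∘ actm (idm X) (act_assoc Y Z M);
  act_unitl_coh : forall (X : C) (M : mc_cat),
    actm (unl X) (idm M) ∘ act_assoc unit X M = act_unit (act X M);
  act_unitr_coh : forall (X : C) (M : mc_cat),
    actm (unr X) (idm M) ∘ act_assoc X unit M = actm (idm X) (act_unit M) }.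

Arguments act {C m} X M.
Arguments actm {C m X X' M M'} f g.
Arguments act_assoc {C m} X Y M.
Arguments act_unit {C m} M.

Notation "X ∗ M" := (act X M) (at level 35, right associativity) : cat_scope.
Notation "f ⊛ g" := (actm f g) (at level 35, right associativity) : cat_scope.

Section ModuleEndofunctors.
Variables (C : StrictMonoidalCategory) (M : ModuleCategory C).

Record mfun := MkMfun {
  fo :> M -> M;
  fm : forall m n : M, Hom m n -> Hom (fo m) (fo n);
  fm_id : forall m, fm (idm m) = idm (fo m);
  fm_comp : forall (m n p : M) (g : Hom n p) (f : Hom m n),
    fm (g ∘ f) = fm g ∘ fm f;
  fs : forall (X : C) (m : M), Hom (fo (X ∗ m)) (X ∗ fo m);
  fs_iso : forall X m, is_iso (fs X m);
  fs_nat : forall (X X' : C) (m m' : M) (f : Hom X X') (g : Hom m m'),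
    fs X' m' ∘ fm (f ⊛ g) = (f ⊛ fm g) ∘ fs X m;
  fs_assoc : forall (X Y : C) (m : M),
    fs (X ⊗ Y) m ∘ fm (act_assoc X Y m) =
    act_assoc X Y (fo m) ∘ (idm X ⊛ fs Y m) ∘ fs X (Y ∗ m);
  fs_unit : forall m : M, act_unit (fo m) ∘ fs unit m = fm (act_unit m) }.

Record mnat (F G : mfun) := MkMnat {
  nt :> forall m : M, Hom (F m) (G m);
  nt_nat : forall (m n : M) (f : Hom m n), nt n ∘ fm F f = fm G f ∘ nt m;
  nt_mod : forall (X : C) (m : M),
    fs G X m ∘ nt (X ∗ m) = (idm X ⊛ nt m) ∘ fs F X m }.

Lemma mnat_eq (F G : mfun) (s t : mnat F G) : (forall m, s m = t m) -> s = t.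
Proof.
case: s t => s Hs Hs' [t Ht Ht'] /= E.
have {}E : s = t by exact: functional_extensionality_dep.
subst t; f_equal; exact: proof_irrelevance.
Qed.

Lemma mfun_eq o m s s' p1 p2 p3 p4 p5 p6 q1 q2 q3 q4 q5 q6 :
  (forall X x, s X x = s' X x) ->
  @MkMfun o m p1 p2 s p3 p4 p5 p6 = @MkMfun o m q1 q2 s' q3 q4 q5 q6.
Proof.
move=> E; have {}E : s = s'.
  by apply: functional_extensionality_dep => X; apply: functional_extensionality_dep.
subst s'; f_equal; exact: proof_irrelevance.
Qed.

Program Definition mnat_idm (F : mfun) : mnat F F :=
  @MkMnat F F (fun m => idm (F m)) _ _.
Next Obligation. by move=> F m n f; rewrite comp_idl comp_idr. Qed.
Next Obligation. by move=> F X m; rewrite actm_id comp_idl comp_idr. Qed.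

Program Definition mnat_comp (F G H : mfun) (t : mnat G H) (s : mnat F G) :
  mnat F H := @MkMnat F H (fun m => t m ∘ s m) _ _.
Next Obligation.
by move=> F G H t s m n f; rewrite -comp_assoc nt_nat comp_assoc nt_nat comp_assoc.
Qed.
Next Obligation.
move=> F G H t s X m; rewrite comp_assoc nt_mod -comp_assoc nt_mod comp_assoc.
by rewrite -actm_comp comp_idl.
Qed.

Program Definition mfun_cat : Category :=
  @MkCategory mfun mnat mnat_idm mnat_comp _ _ _.
Next Obligation. by move=> *; apply: mnat_eq => m; exact: comp_assoc. Qed.
Next Obligation. by move=> *; apply: mnat_eq => m; exact: comp_idl. Qed.
Next Obligation. by move=> *; apply: mnat_eq => m; exact: comp_idr. Qed.

Program Definition mfun_id : mfun :=
  @MkMfun (fun m => m) (fun m n f => f) _ _ (fun X m => idm (X ∗ m)) _ _ _ _.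
Next Obligation. by []. Qed.
Next Obligation. by []. Qed.
Next Obligation. by move=> *; exact: is_iso_idm. Qed.
Next Obligation. by move=> *; rewrite comp_idl comp_idr. Qed.
Next Obligation. by move=> *; rewrite actm_id comp_idl !comp_idr. Qed.
Next Obligation. by move=> *; rewrite comp_idr. Qed.

Lemma fm_iso (F : mfun) (m n : M) (f : Hom m n) : is_iso f -> is_iso (fm F f).
Proof. by move=> [g [g1 g2]]; exists (fm F g); rewrite -!fm_comp g1 g2 !fm_id. Qed.

Program Definition mfun_comp (F G : mfun) : mfun :=
  @MkMfun (fun m => F (G m)) (fun m n f => fm F (fm G f)) _ _
    (fun X m => fs F X (G m) ∘ fm F (fs G X m)) _ _ _ _.
Next Obligation. by move=> F G m /=; rewrite !fm_id. Qed.
Next Obligation. by move=> F G * /=; rewrite !fm_comp. Qed.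
Next Obligation.
by move=> F G X m; apply: is_iso_comp; [|apply: fm_iso]; exact: fs_iso.
Qed.
Next Obligation.
move=> F G X X' m m' f g /=; rewrite -comp_assoc -fm_comp fs_nat fm_comp.
by rewrite comp_assoc fs_nat comp_assoc.
Qed.
Next Obligation.
move=> F G X Y m /=; rewrite -comp_assoc -fm_comp fs_assoc !fm_comp !comp_assoc.
rewrite fs_assoc -!(comp_assoc _ _ (fm F (idm X ⊛ _))) fs_nat.
rewrite -!comp_assoc (comp_assoc (idm X ⊛ _) (idm X ⊛ _)) -actm_comp comp_idl.
done.
Qed.
Next Obligation.
by move=> F G m /=; rewrite comp_assoc fs_unit -fm_comp fs_unit.
Qed.

Program Definition mnat_hcomp (F F' G G' : mfun) (s : mnat F F')
    (t : mnat G G') : mnat (mfun_comp F G) (mfun_comp F' G') :=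
  @MkMnat (mfun_comp F G) (mfun_comp F' G')
    (fun m => s (G' m) ∘ fm F (t m)) _ _.
Next Obligation.
move=> F F' G G' s t m n f; rewrite /= -comp_assoc -fm_comp (nt_nat t) fm_comp.
by rewrite !comp_assoc nt_nat.
Qed.
Next Obligation.
move=> F F' G G' s t X m /=.
rewrite -!comp_assoc (comp_assoc _ (s _)) -nt_nat -(comp_assoc (s _)) -fm_comp.
rewrite nt_mod fm_comp !comp_assoc nt_mod -!comp_assoc.
rewrite (comp_assoc (fs F _ _)) fs_nat !comp_assoc -actm_comp.
by rewrite comp_idl.
Qed.

Lemma nt_eq_hom (F G : mfun_cat) (p : F = G) (m : M) (q : fo F m = fo G m) :
  nt (eq_hom p) m = eq_hom q.
Proof. by case: G / p q => q; rewrite (uip q eq_refl). Qed.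

Lemma nt_assoc_id (F G H : mfun) m
    (p : mfun_comp (mfun_comp F G) H = mfun_comp F (mfun_comp G H)) :
  nt (@eq_hom mfun_cat _ _ p) m = idm (F (G (H m))).
Proof. exact: (@nt_eq_hom _ _ p m eq_refl). Qed.

Lemma nt_unitl_id (F : mfun) m (p : mfun_comp mfun_id F = F) :
  nt (@eq_hom mfun_cat _ _ p) m = idm (F m).
Proof. exact: (@nt_eq_hom _ _ p m eq_refl). Qed.

Lemma nt_unitr_id (F : mfun) m (p : mfun_comp F mfun_id = F) :
  nt (@eq_hom mfun_cat _ _ p) m = idm (F m).
Proof. exact: (@nt_eq_hom _ _ p m eq_refl). Qed.

Program Definition modend : StrictMonoidalCategory :=
  @MkStrictMonoidal mfun_cat mfun_comp mfun_id mnat_hcomp _ _ _ _ _ _ _ _.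
Next Obligation.
by move=> F G; apply: mnat_eq => m; rewrite /= fm_id comp_idl.
Qed.
Next Obligation.
move=> F F' F'' G G' G'' s' s t' t; apply: mnat_eq => m /=.
rewrite fm_comp -!comp_assoc; congr (_ ∘ _); rewrite !comp_assoc.
by rewrite nt_nat.
Qed.
Next Obligation.
move=> F G H; apply: mfun_eq => X m /=.
by rewrite fm_comp comp_assoc.
Qed.
Next Obligation.
move=> [o m p1 p2 s p3 p4 p5 p6]; apply: mfun_eq => X x /=.
exact: comp_idl.
Qed.
Next Obligation.
move=> [o m p1 p2 s p3 p4 p5 p6]; apply: mfun_eq => X x /=.
by rewrite p1 comp_idr.
Qed.
Next Obligation.
move=> X X' Y Y' Z Z' f g h; apply: mnat_eq => m /=.
by rewrite !nt_assoc_id comp_idl comp_idr fm_comp comp_assoc.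
Qed.
Next Obligation.
move=> X X' f; apply: mnat_eq => m /=.
by rewrite !nt_unitl_id !comp_idl comp_idr.
Qed.
Next Obligation.
move=> X X' f; apply: mnat_eq => m /=.
by rewrite !nt_unitr_id fm_id comp_idl !comp_idr.
Qed.

End ModuleEndofunctors.

Record MonoidalFunctor (D V : StrictMonoidalCategory) := MkMonoidalFunctor {
  mf_ob :> D -> V;
  mf_mor : forall X Y : D, Hom X Y -> Hom (mf_ob X) (mf_ob Y);
  mf_id : forall X, mf_mor (idm X) = idm (mf_ob X);
  mf_comp : forall (X Y Z : D) (g : Hom Y Z) (f : Hom X Y),
    mf_mor (g ∘ f) = mf_mor g ∘ mf_mor f;
  mf_mu : forall X Y : D, Iso (mf_ob X ⊗ mf_ob Y) (mf_ob (X ⊗ Y));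
  mf_eps : Iso unit (mf_ob unit);
  mf_mu_nat : forall (X X' Y Y' : D) (f : Hom X X') (g : Hom Y Y'),
    mf_mu X' Y' ∘ (mf_mor f ⊠ mf_mor g) = mf_mor (f ⊠ g) ∘ mf_mu X Y;
  mf_assoc : forall X Y Z : D,
    mf_mor (asc X Y Z) ∘ mf_mu (X ⊗ Y) Z ∘ (mf_mu X Y ⊠ idm (mf_ob Z)) =
    mf_mu X (Y ⊗ Z) ∘ (idm (mf_ob X) ⊠ mf_mu Y Z)
      ∘ asc (mf_ob X) (mf_ob Y) (mf_ob Z);
  mf_unitl : forall X : D,
    mf_mor (unl X) ∘ mf_mu unit X ∘ (mf_eps ⊠ idm (mf_ob X)) = unl (mf_ob X);
  mf_unitr : forall X : D,
    mf_mor (unr X) ∘ mf_mu X unit ∘ (idm (mf_ob X) ⊠ mf_eps) = unr (mf_ob X) }.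

Section IsoLemmas.
Variable C : Category.

Lemma iso_cancel (X Y Z : C) (i : Iso Y Z) (f g : Hom X Y) :
  fwd i ∘ f = fwd i ∘ g -> f = g.
Proof.
move=> E; rewrite -[f]comp_idl -[g]comp_idl -(bwd_fwd i) -!comp_assoc.
by rewrite E.
Qed.

Lemma bwd_eq (X Y Z : C) (i : Iso Y Z) (f : Hom X Z) (g : Hom X Y) :
  f = fwd i ∘ g -> bwd i ∘ f = g.
Proof. by move=> ->; rewrite comp_assoc bwd_fwd comp_idl. Qed.

Lemma bwd_nat (X Y X' Y' : C) (i : Iso X Y) (j : Iso X' Y') (f : Hom X X')
    (g : Hom Y Y') : j ∘ f = g ∘ i -> bwd j ∘ g = f ∘ bwd i.
Proof.
move=> E; apply: bwd_eq.
by rewrite comp_assoc E -comp_assoc fwd_bwd comp_idr.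
Qed.

Lemma pre1 (X Y Z W : C) (b : Hom X Y) (a : Hom Y Z) (c : Hom X Z) :
  a ∘ b = c -> forall h : Hom Z W, h ∘ a ∘ b = h ∘ c.
Proof. by move=> <- h; rewrite comp_assoc. Qed.

Lemma pre2 (X Y Y' Z W : C) (b : Hom X Y) (a : Hom Y Z) (d : Hom X Y')
    (c : Hom Y' Z) :
  a ∘ b = c ∘ d -> forall h : Hom Z W, h ∘ a ∘ b = h ∘ c ∘ d.
Proof. by move=> E h; rewrite -!comp_assoc E. Qed.

Lemma pre0 (X Y W : C) (b : Hom X Y) (a : Hom Y X) :
  a ∘ b = idm X -> forall h : Hom X W, h ∘ a ∘ b = h.
Proof. by move=> E h; rewrite -comp_assoc E comp_idr. Qed.

End IsoLemmas.

Section Comma.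
Variables (D V : StrictMonoidalCategory) (F : MonoidalFunctor D V).

Lemma mf_mor_eq_hom (X Y : D) (p : X = Y) :
  mf_mor F (eq_hom p) = eq_hom (f_equal F p).
Proof. by case: Y / p; exact: mf_id. Qed.

Record comma_ob := MkCommaOb {
  comma_base : D;
  comma_map : Hom (F comma_base) unit }.

Record comma_hom (X Y : comma_ob) := MkCommaHom {
  comma_mor : Hom (comma_base X) (comma_base Y);
  comma_mor_map : comma_map Y ∘ mf_mor F comma_mor = comma_map X }.

Lemma comma_hom_eq (Z W : comma_ob) (f g : comma_hom Z W) :
  comma_mor f = comma_mor g -> f = g.
Proof.
case: f g => f Hf [g Hg] /= E; subst g; f_equal; exact: proof_irrelevance.
Qed.

Lemma comma_ob_eq (Z W : comma_ob) :
  comma_base Z = comma_base W -> heq (comma_map Z) (comma_map W) -> Z = W.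
Proof. by case: Z W => Z z [W w] /= p; subst W => /heq_eq ->. Qed.

Program Definition comma_idm (Z : comma_ob) : comma_hom Z Z :=
  @MkCommaHom Z Z (idm (comma_base Z)) _.
Next Obligation. by move=> Z; rewrite mf_id comp_idr. Qed.

Program Definition comma_comp (Z W U : comma_ob) (g : comma_hom W U)
    (f : comma_hom Z W) : comma_hom Z U :=
  @MkCommaHom Z U (comma_mor g ∘ comma_mor f) _.
Next Obligation.
by move=> Z W U g f; rewrite mf_comp comp_assoc !comma_mor_map.
Qed.

Program Definition comma_cat : Category :=
  @MkCategory comma_ob comma_hom comma_idm comma_comp _ _ _.
Next Obligation. by move=> *; apply: comma_hom_eq; exact: comp_assoc. Qed.
Next Obligation. by move=> *; apply: comma_hom_eq; exact: comp_idl. Qed.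
Next Obligation. by move=> *; apply: comma_hom_eq; exact: comp_idr. Qed.

Definition comma_tens (Z W : comma_ob) : comma_ob :=
  @MkCommaOb (comma_base Z ⊗ comma_base W)
    (unl unit ∘ (comma_map Z ⊠ comma_map W)
       ∘ bwd (mf_mu F (comma_base Z) (comma_base W))).

Definition comma_unit : comma_ob := @MkCommaOb unit (bwd (mf_eps F)).

Program Definition comma_tensm (Z Z' W W' : comma_ob) (f : comma_hom Z Z')
    (g : comma_hom W W') : comma_hom (comma_tens Z W) (comma_tens Z' W') :=
  @MkCommaHom (comma_tens Z W) (comma_tens Z' W') (comma_mor f ⊠ comma_mor g) _.
Next Obligation.
move=> Z Z' W W' f g.
rewrite /= -comp_assoc (bwd_nat (mf_mu_nat F (comma_mor f) (comma_mor g))).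
rewrite comp_assoc -(comp_assoc (unl _)) -tensm_comp !comma_mor_map.
done.
Qed.

Lemma comma_mor_eq_hom (Z W : comma_cat) (p : Z = W)
    (q : comma_base Z = comma_base W) : comma_mor (eq_hom p) = eq_hom q.
Proof. by case: W / p q => q; rewrite (uip q eq_refl). Qed.

Lemma mf_assoc_bwd (X Y Z : D) :
  heq ((bwd (mf_mu F X Y) ⊠ idm (F Z)) ∘ bwd (mf_mu F (X ⊗ Y) Z))
      ((idm (F X) ⊠ bwd (mf_mu F Y Z)) ∘ bwd (mf_mu F X (Y ⊗ Z))).
Proof.
apply: (heq_intro (p := f_equal F (tens_assoc X Y Z))
  (q := tens_assoc (F X) (F Y) (F Z))).
rewrite -mf_mor_eq_hom -/(asc X Y Z) -/(asc (F X) (F Y) (F Z)).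
set P := mf_mu F (X ⊗ Y) Z; set Q := mf_mu F X (Y ⊗ Z).
have E : mf_mor F (asc X Y Z) ∘ P = Q ∘ (idm (F X) ⊠ mf_mu F Y Z)
    ∘ asc (F X) (F Y) (F Z) ∘ (bwd (mf_mu F X Y) ⊠ idm (F Z)).
  rewrite -mf_assoc -comp_assoc -tensm_comp fwd_bwd comp_idl tensm_id.
  by rewrite comp_idr.
rewrite -[mf_mor F _]comp_idr -(fwd_bwd P) [in RHS](comp_assoc (mf_mor _ _)) E.
rewrite !comp_assoc (pre0 (bwd_fwd Q)) -tensm_comp bwd_fwd comp_idl.
by rewrite tensm_id comp_idl.
Qed.

Program Definition comma : StrictMonoidalCategory :=
  @MkStrictMonoidal comma_cat comma_tens comma_unit comma_tensm
    _ _ _ _ _ _ _ _.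
Next Obligation. by move=> *; apply: comma_hom_eq; exact: tensm_id. Qed.
Next Obligation. by move=> *; apply: comma_hom_eq; exact: tensm_comp. Qed.
Next Obligation.
move=> [X f] [Y g] [Z h]; apply: comma_ob_eq => /=; first exact: tens_assoc.
rewrite -[h in X in heq X _]comp_idr -[f in X in heq _ X]comp_idr.
rewrite !tensm_comp !comp_assoc -(comp_assoc _ (bwd _ ⊠ _)).
rewrite -[in X in heq _ X](comp_assoc _ (idm _ ⊠ _)).
apply: heq_comp; last exact: mf_assoc_bwd.
apply: heq_castl; apply: heq_sym; apply: heq_castl; apply: heq_sym.
rewrite -[h in X in heq X _]comp_idl -[f in X in heq _ X]comp_idl.
rewrite !tensm_comp tensm_eq_homl tensm_eq_homr.
apply: heq_castl; apply: heq_sym; apply: heq_castl; apply: heq_sym.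
exact: heq_assoc.
Qed.
Next Obligation.
move=> [X f]; apply: comma_ob_eq => /=; first exact: tens_unitl.
rewrite tensm_split' comp_assoc /unl tensm_unitl -/(unl (F X)) -mf_unitl.
rewrite -!comp_assoc (comp_assoc (mf_eps F ⊠ _)) -tensm_comp fwd_bwd comp_idl.
rewrite tensm_id comp_idl fwd_bwd comp_idr /unl mf_mor_eq_hom.
exact: heq_castr.
Qed.
Next Obligation.
move=> [X f]; apply: comma_ob_eq => /=; first exact: tens_unitr.
rewrite tensm_split comp_assoc.
have -> : unl unit = unr unit :> Hom (unit ⊗ unit : V) unit by exact: eq_hom_irr.
rewrite /unr tensm_unitr -/(unr (F X)) -mf_unitr.
rewrite -!comp_assoc (comp_assoc (_ ⊠ mf_eps F)) -tensm_comp fwd_bwd comp_idl.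
rewrite tensm_id comp_idl fwd_bwd comp_idr /unr mf_mor_eq_hom.
exact: heq_castr.
Qed.
Next Obligation.
move=> X X' Y Y' Z Z' f g h; apply: comma_hom_eq.
by rewrite /= !(@comma_mor_eq_hom (comma_tens (comma_tens _ _) _)
  (comma_tens _ (comma_tens _ _)) _ (tens_assoc _ _ _));
  exact: (tensm_assoc (comma_mor f) (comma_mor g) (comma_mor h)).
Qed.
Next Obligation.
move=> X X' f; apply: comma_hom_eq.
by rewrite /= !(@comma_mor_eq_hom (comma_tens comma_unit _) _ _
  (tens_unitl _)); exact: (tensm_unitl (comma_mor f)).
Qed.
Next Obligation.
move=> X X' f; apply: comma_hom_eq.
by rewrite /= !(@comma_mor_eq_hom (comma_tens _ comma_unit) _ _
  (tens_unitr _)); exact: (tensm_unitr (comma_mor f)).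
Qed.

Program Definition comma_forget (B : Algebra comma) : Algebra D :=
  @MkAlgebra D (comma_base (alg_ob B)) (comma_mor (mul B)) (comma_mor (one B))
    _ _ _.
Next Obligation.
move=> B; apply: (eq_trans (f_equal (@comma_mor _ _) (mul_assoc B))).
pose Z := comma_base (alg_ob B); pose m : Hom (Z ⊗ Z) Z := comma_mor (mul B).
apply: (f_equal (comp (m ∘ (idm Z ⊠ m)))).
exact: (comma_mor_eq_hom (@tens_assoc comma B B B) (@tens_assoc D Z Z Z)).
Qed.
Next Obligation.
move=> B; apply: (eq_trans (f_equal (@comma_mor _ _) (mul_onel B))).
exact: (comma_mor_eq_hom (@tens_unitl comma B)
  (@tens_unitl D (comma_base (alg_ob B)))).
Qed.
Next Obligation.
move=> B; apply: (eq_trans (f_equal (@comma_mor _ _) (mul_oner B))).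
exact: (comma_mor_eq_hom (@tens_unitr comma B)
  (@tens_unitr D (comma_base (alg_ob B)))).
Qed.

End Comma.

Section ModuleCentre.
Variables (C : StrictMonoidalCategory) (M : ModuleCategory C).

Lemma actm_compl (X Y Z : C) (m : M) (g : Hom Y Z) (f : Hom X Y) :
  (g ∘ f) ⊛ idm m = (g ⊛ idm m) ∘ (f ⊛ idm m).
Proof. by rewrite -actm_comp comp_idl. Qed.

Lemma actm_compr (X : C) (m n p : M) (g : Hom n p) (f : Hom m n) :
  idm X ⊛ (g ∘ f) = (idm X ⊛ g) ∘ (idm X ⊛ f).
Proof. by rewrite -actm_comp comp_idl. Qed.

Lemma actm_swap (X X' : C) (m m' : M) (f : Hom X X') (g : Hom m m') :
  (f ⊛ idm m') ∘ (idm X ⊛ g) = (idm X' ⊛ g) ∘ (f ⊛ idm m).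
Proof. by rewrite -!actm_comp !comp_idl !comp_idr. Qed.

Lemma actm_bwd_fwd (X : C) (m n : M) (i : Iso m n) :
  (idm X ⊛ bwd i) ∘ (idm X ⊛ fwd i) = idm (X ∗ m).
Proof. by rewrite -actm_compr bwd_fwd actm_id. Qed.

Lemma actm_fwd_bwd (X : C) (m n : M) (i : Iso m n) :
  (idm X ⊛ fwd i) ∘ (idm X ⊛ bwd i) = idm (X ∗ n).
Proof. by rewrite -actm_compr fwd_bwd actm_id. Qed.

Lemma act_assoc_natl (X X' Y : C) (m : M) (f : Hom X X') :
  ((f ⊠ idm Y) ⊛ idm m) ∘ act_assoc X Y m = act_assoc X' Y m ∘ (f ⊛ idm (Y ∗ m)).
Proof. by rewrite -act_assoc_nat actm_id. Qed.

Lemma act_assoc_natm (X Y Y' : C) (m : M) (f : Hom Y Y') :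
  ((idm X ⊠ f) ⊛ idm m) ∘ act_assoc X Y m =
  act_assoc X Y' m ∘ (idm X ⊛ (f ⊛ idm m)).
Proof. by rewrite -act_assoc_nat. Qed.

Lemma act_asc'_coh (X Y Z : C) (m : M) :
  (asc' X Y Z ⊛ idm m) ∘ act_assoc X (Y ⊗ Z) m ∘ (idm X ⊛ act_assoc Y Z m) =
  act_assoc (X ⊗ Y) Z m ∘ act_assoc X Y (Z ∗ m).
Proof.
rewrite -comp_assoc -act_assoc_coh !comp_assoc -actm_compl asc'_asc actm_id.
by rewrite comp_idl.
Qed.

Definition centre_act_str (Z : centre_ob C) (X : C) (m : M) :
    Hom (cob Z ∗ X ∗ m) (X ∗ cob Z ∗ m) :=
  bwd (act_assoc X (cob Z) m) ∘ (hbr Z X ⊛ idm m) ∘ act_assoc (cob Z) X m.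

Lemma centre_act_strE (Z : centre_ob C) (X : C) (m : M) :
  act_assoc X (cob Z) m ∘ centre_act_str Z X m =
  (hbr Z X ⊛ idm m) ∘ act_assoc (cob Z) X m.
Proof. by rewrite /centre_act_str !comp_assoc fwd_bwd comp_idl. Qed.

Lemma centre_act_str_iso (Z : centre_ob C) (X : C) (m : M) :
  is_iso (centre_act_str Z X m).
Proof.
apply: is_iso_comp; last exact: is_iso_fwd.
apply: is_iso_comp; first exact: is_iso_bwd.
have [g [g1 g2]] := hbr_iso Z X; exists (g ⊛ idm m).
by rewrite -!actm_compl g1 g2 !actm_id.
Qed.

Program Definition centre_act_ob (Z : centre_ob C) : mfun M :=
  @MkMfun C M (fun m => cob Z ∗ m) (fun m n f => idm (cob Z) ⊛ f) _ _
    (centre_act_str Z) _ _ _ _.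
Next Obligation. by move=> Z m; exact: actm_id. Qed.
Next Obligation. by move=> *; exact: actm_compr. Qed.
Next Obligation. exact: centre_act_str_iso. Qed.
Next Obligation.
move=> Z X X' m m' f g /=.
move: (centre_act_str Z) (centre_act_strE Z) => s sE.
apply: (@iso_cancel _ _ _ _ (act_assoc X' (cob Z) m')).
rewrite !comp_assoc sE (pre2 (act_assoc_nat _ _ _)).
rewrite act_assoc_nat -actm_comp hbr_nat comp_idl.
rewrite -(comp_assoc (_ ⊛ g)) sE comp_assoc -actm_comp.
by rewrite comp_idr.
Qed.
Next Obligation.
move=> Z X Y m /=.
move: (centre_act_str Z) (centre_act_strE Z) => s sE.
apply: (@iso_cancel _ _ _ _ (act_assoc (X ⊗ Y) (cob Z) m)).
rewrite !comp_assoc sE -[LHS]comp_assoc -act_assoc_coh.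
rewrite !comp_assoc -actm_compl hbr_tens.
rewrite (pre0 (asc'_asc _ _ _)) !actm_compl.
rewrite (pre2 (act_assoc_natl _ _ _)) -[LHS]comp_assoc -sE.
rewrite -act_asc'_coh -(comp_assoc _ _ (idm X ⊛ s Y m)) -actm_compr (sE Y m).
rewrite actm_compr !comp_assoc (pre2 (eq_sym (act_assoc_natm _ _ _))).
rewrite -(comp_assoc _ (act_assoc X (cob Z ⊗ Y) m)) -act_assoc_coh.
by rewrite !comp_assoc.
Qed.
Next Obligation.
move=> Z m /=; move: (centre_act_str Z) (centre_act_strE Z) => s sE.
rewrite -act_unitl_coh -comp_assoc sE comp_assoc.
rewrite -actm_compl hbr_unit comp_assoc /unl /unl' eq_hom_comp eq_hom_id.
by rewrite comp_idl act_unitr_coh.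
Qed.

Program Definition centre_act_mor (Z W : centre C) (h : Hom Z W) :
    mnat (centre_act_ob Z) (centre_act_ob W) :=
  @MkMnat C M (centre_act_ob Z) (centre_act_ob W) (fun m => chom h ⊛ idm m) _ _.
Next Obligation. by move=> Z W h m n f; exact: actm_swap. Qed.
Next Obligation.
move=> Z W h X m /=.
move: (centre_act_str Z) (centre_act_strE Z) => s sE.
move: (centre_act_str W) (centre_act_strE W) => t tE.
apply: (@iso_cancel _ _ _ _ (act_assoc X (cob W) m)).
rewrite !comp_assoc tE -act_assoc_natm -!comp_assoc.
rewrite sE -act_assoc_natl !comp_assoc -!actm_compl.
by rewrite chom_hbr.
Qed.

Lemma centre_act_mu_mod (Z W : centre_ob C) (X : C) (m : M) :
  centre_act_str (centre_tens Z W) X m ∘ act_assoc (cob Z) (cob W) (X ∗ m) =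
  (idm X ⊛ act_assoc (cob Z) (cob W) m)
    ∘ (centre_act_str Z X (cob W ∗ m) ∘ (idm (cob Z) ⊛ centre_act_str W X m)).
Proof.
apply: (@iso_cancel _ _ _ _ (act_assoc X (cob Z ⊗ cob W) m)).
move: (centre_act_str (centre_tens Z W)) (centre_act_strE (centre_tens Z W)).
move=> /= r rE; move: (centre_act_str Z) (centre_act_strE Z) => s sE.
move: (centre_act_str W) (centre_act_strE W) => t tE.
rewrite [LHS]comp_assoc rE /hbr_prod !actm_compl.
rewrite -[LHS]comp_assoc -(comp_assoc _ (asc _ _ _ ⊛ _)) (comp_assoc (asc _ _ _ ⊛ _)).
rewrite act_assoc_coh comp_assoc (pre2 (act_assoc_natm _ _ _)).
rewrite -[LHS]comp_assoc -actm_compr -tE actm_compr comp_assoc.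
rewrite -(comp_assoc _ (act_assoc (cob Z) (X ⊗ cob W) m)).
rewrite -(comp_assoc _ (asc' _ _ _ ⊛ _)) (comp_assoc (asc' _ _ _ ⊛ _)).
rewrite act_asc'_coh !comp_assoc.
rewrite (pre2 (act_assoc_natl _ _ _)) (pre2 (eq_sym (sE _ _))).
by rewrite act_assoc_coh.
Qed.

Lemma bwd_mod (X : C) (m m' n n' : M) (i : Iso m m') (j : Iso n n')
    (f : Hom n (X ∗ m)) (g : Hom n' (X ∗ m')) :
  g ∘ j = (idm X ⊛ i) ∘ f -> f ∘ bwd j = (idm X ⊛ bwd i) ∘ g.
Proof.
move=> E; rewrite -[g]comp_idr -(fwd_bwd j) (comp_assoc g) E !comp_assoc.
by rewrite actm_bwd_fwd comp_idl.
Qed.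

Program Definition centre_act_mu (Z W : centre C) :
    @Iso (mfun_cat M) (mfun_comp (centre_act_ob Z) (centre_act_ob W))
      (centre_act_ob (Z ⊗ W)) :=
  @MkIso (mfun_cat M) (mfun_comp (centre_act_ob Z) (centre_act_ob W))
    (centre_act_ob (Z ⊗ W))
    (@MkMnat C M (mfun_comp (centre_act_ob Z) (centre_act_ob W))
       (centre_act_ob (Z ⊗ W))
       (fun m => act_assoc (cob Z) (cob W) m) _ _)
    (@MkMnat C M (centre_act_ob (Z ⊗ W))
       (mfun_comp (centre_act_ob Z) (centre_act_ob W))
       (fun m => bwd (act_assoc (cob Z) (cob W) m)) _ _) _ _.
Next Obligation.
by move=> Z W m n f /=; rewrite act_assoc_nat tensm_id.
Qed.
Next Obligation. by move=> Z W X m; exact: centre_act_mu_mod. Qed.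
Next Obligation.
by move=> Z W m n f /=; apply: bwd_nat; rewrite act_assoc_nat tensm_id.
Qed.
Next Obligation.
by move=> Z W X m; apply: bwd_mod; exact: centre_act_mu_mod.
Qed.
Next Obligation. by move=> Z W; apply: mnat_eq => m; exact: bwd_fwd. Qed.
Next Obligation. by move=> Z W; apply: mnat_eq => m; exact: fwd_bwd. Qed.

Lemma centre_act_eps_mod (X : C) (m : M) :
  idm (X ∗ m) ∘ act_unit (X ∗ m) =
  (idm X ⊛ act_unit m) ∘ centre_act_str (centre_unit C) X m.
Proof.
move: (centre_act_str (centre_unit C)) (centre_act_strE (centre_unit C)).
move=> /= s sE; rewrite comp_idl -act_unitr_coh -comp_assoc sE comp_assoc.
rewrite -actm_compl comp_assoc /unr /unr' eq_hom_comp eq_hom_id comp_idl.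
by rewrite act_unitl_coh.
Qed.

Program Definition centre_act_eps :
    @Iso (mfun_cat M) (mfun_id M) (centre_act_ob (centre_unit C)) :=
  @MkIso (mfun_cat M) (mfun_id M) (centre_act_ob (centre_unit C))
    (@MkMnat C M (mfun_id M) (centre_act_ob (centre_unit C))
       (fun m => bwd (act_unit m)) _ _)
    (@MkMnat C M (centre_act_ob (centre_unit C)) (mfun_id M)
       (fun m => fwd (act_unit m)) _ _) _ _.
Next Obligation. by move=> m n f; apply: bwd_nat; exact: act_unit_nat. Qed.
Next Obligation. by move=> X m; apply: bwd_mod; exact: centre_act_eps_mod. Qed.
Next Obligation. by move=> m n f; exact: act_unit_nat. Qed.
Next Obligation. by move=> X m; exact: centre_act_eps_mod. Qed.
Next Obligation. by apply: mnat_eq => m; exact: fwd_bwd. Qed.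
Next Obligation. by apply: mnat_eq => m; exact: bwd_fwd. Qed.

Program Definition centre_act : MonoidalFunctor (centre C) (modend M) :=
  @MkMonoidalFunctor (centre C) (modend M) centre_act_ob centre_act_mor _ _
    centre_act_mu centre_act_eps _ _ _ _.
Next Obligation. by move=> Z; apply: mnat_eq => m; exact: actm_id. Qed.
Next Obligation. by move=> *; apply: mnat_eq => m; exact: actm_compl. Qed.
Next Obligation.
move=> Z Z' W W' f g; apply: mnat_eq => m /=.
by rewrite -actm_comp comp_idl comp_idr act_assoc_nat.
Qed.
Next Obligation.
move=> X Y Z; apply: mnat_eq => m /=.
have -> : chom (asc X Y Z) = asc (cob X) (cob Y) (cob Z).
  exact: (@chom_eq_hom C _ _ (@tens_assoc (centre C) X Y Z)
    (tens_assoc (cob X) (cob Y) (cob Z))).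
have -> : nt (@asc (modend M) (centre_act_ob X) (centre_act_ob Y)
    (centre_act_ob Z)) m = idm _ by exact: nt_assoc_id.
rewrite !actm_id !comp_idr comp_idl.
exact: act_assoc_coh.
Qed.
Next Obligation.
move=> X; apply: mnat_eq => m /=.
have -> : chom (unl X) = unl (cob X).
  exact: (@chom_eq_hom C _ _ (@tens_unitl (centre C) X) (tens_unitl (cob X))).
have -> : nt (@unl (modend M) (centre_act_ob X)) m = idm _
  by exact: nt_unitl_id.
rewrite !comp_idr act_unitl_coh.
exact: fwd_bwd.
Qed.
Next Obligation.
move=> X; apply: mnat_eq => m /=.
have -> : chom (unr X) = unr (cob X).
  exact: (@chom_eq_hom C _ _ (@tens_unitr (centre C) X) (tens_unitr (cob X))).
have -> : nt (@unr (modend M) (centre_act_ob X)) m = idm _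
  by exact: nt_unitr_id.
rewrite comp_idl act_unitr_coh.
exact: actm_fwd_bwd.
Qed.

Definition ModuleCentre := Terminal (comma_cat centre_act).

Definition module_centre_algebra (T : ModuleCentre) : Algebra (centre C) :=
  comma_forget (@terminal_algebra (comma centre_act) T).

End ModuleCentre.

Section RightModules.
Variables (C : StrictMonoidalCategory) (A : Algebra C).

Record rmod := MkRmod {
  rm_ob :> C;
  rm_act : Hom (rm_ob ⊗ A) rm_ob;
  rm_mul : rm_act ∘ (rm_act ⊠ idm A) =
           rm_act ∘ (idm rm_ob ⊠ mul A) ∘ asc rm_ob A A;
  rm_one : rm_act ∘ (idm rm_ob ⊠ one A) = unr rm_ob }.

Record rmod_hom (M N : rmod) := MkRmodHom {
  rm_hom :> Hom (rm_ob M) (rm_ob N);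
  rm_hom_act : rm_act N ∘ (rm_hom ⊠ idm A) = rm_hom ∘ rm_act M }.

Lemma rmod_hom_eq (M N : rmod) (f g : rmod_hom M N) :
  rm_hom f = rm_hom g -> f = g.
Proof.
case: f g => f Hf [g Hg] /= E; subst g; f_equal; exact: proof_irrelevance.
Qed.

Program Definition rmod_idm (M : rmod) : rmod_hom M M :=
  @MkRmodHom M M (idm (rm_ob M)) _.
Next Obligation. by move=> M; rewrite tensm_id comp_idl comp_idr. Qed.

Program Definition rmod_comp (M N P : rmod) (g : rmod_hom N P)
    (f : rmod_hom M N) : rmod_hom M P := @MkRmodHom M P (g ∘ f) _.
Next Obligation.
by move=> M N P g f; rewrite tensm_compl comp_assoc rm_hom_act -comp_assoc
  rm_hom_act comp_assoc.
Qed.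

Program Definition rmod_cat : Category :=
  @MkCategory rmod rmod_hom rmod_idm rmod_comp _ _ _.
Next Obligation. by move=> *; apply: rmod_hom_eq; exact: comp_assoc. Qed.
Next Obligation. by move=> *; apply: rmod_hom_eq; exact: comp_idl. Qed.
Next Obligation. by move=> *; apply: rmod_hom_eq; exact: comp_idr. Qed.

Program Definition rmod_act (X : C) (M : rmod) : rmod :=
  @MkRmod (X ⊗ rm_ob M) ((idm X ⊠ rm_act M) ∘ asc X M A) _ _.
Next Obligation.
move=> X M; rewrite tensm_compl comp_assoc (pre2 (asc_nat _ _ _)).
rewrite -tensm_compr rm_mul !tensm_compr -tensm_id (pre2 (asc_nat _ _ _)).
rewrite -!comp_assoc; congr (_ ∘ (_ ∘ _)).
rewrite /asc tensm_eq_homl tensm_eq_homr !eq_hom_comp; exact: eq_hom_irr.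
Qed.
Next Obligation.
move=> X M; rewrite -tensm_id (pre2 (asc_nat _ _ _)) -tensm_compr rm_one.
rewrite /unr /asc tensm_eq_homr eq_hom_comp; exact: eq_hom_irr.
Qed.

Program Definition rmod_actm (X X' : C) (M M' : rmod) (f : Hom X X')
    (g : rmod_hom M M') : rmod_hom (rmod_act X M) (rmod_act X' M') :=
  @MkRmodHom (rmod_act X M) (rmod_act X' M') (f ⊠ rm_hom g) _.
Next Obligation.
move=> X X' M M' f g /=; rewrite (pre2 (asc_nat _ _ _)) comp_assoc.
by rewrite -!tensm_comp rm_hom_act comp_idl comp_idr.
Qed.

(* isomorphism of modules whose underlying morphism is an identity of [C] *)
Program Definition rmod_cast (M N : rmod) (p : rm_ob M = rm_ob N)
    (H : heq (rm_act M) (rm_act N)) : @Iso rmod_cat M N :=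
  @MkIso rmod_cat M N (@MkRmodHom M N (eq_hom p) _)
    (@MkRmodHom N M (eq_hom (eq_sym p)) _) _ _.
Next Obligation.
by move=> M N p H; rewrite tensm_eq_homl -(heqE _ p H).
Qed.
Next Obligation.
by move=> M N p H; rewrite tensm_eq_homl -(heqE _ (eq_sym p) (heq_sym H)).
Qed.
Next Obligation.
by move=> M N p H; apply: rmod_hom_eq; rewrite /= eq_hom_comp eq_hom_id.
Qed.
Next Obligation.
by move=> M N p H; apply: rmod_hom_eq; rewrite /= eq_hom_comp eq_hom_id.
Qed.

Lemma rmod_act_assoc_heq (X Y : C) (M : rmod) :
  heq (rm_act (rmod_act X (rmod_act Y M))) (rm_act (rmod_act (X ⊗ Y) M)).
Proof.
rewrite /= -tensm_id tensm_compr -comp_assoc.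
apply: (@heq_trans _ _ _ _ _ _ _ _ (idm X ⊠ (idm Y ⊠ rm_act M))).
  by rewrite /asc tensm_eq_homr eq_hom_comp; exact: heq_castr.
by apply: heq_sym; apply: heq_castr; exact: heq_assoc.
Qed.

Lemma rmod_act_unit_heq (M : rmod) :
  heq (rm_act (rmod_act unit M)) (rm_act M).
Proof. by apply: heq_castr; exact: heq_unitl. Qed.

Program Definition rmod_mc : ModuleCategory C :=
  @MkModuleCategory C rmod_cat rmod_act rmod_actm _ _
    (fun X Y M => @rmod_cast (rmod_act X (rmod_act Y M)) (rmod_act (X ⊗ Y) M)
       (eq_sym (tens_assoc X Y M)) (@rmod_act_assoc_heq X Y M))
    (fun M => @rmod_cast (rmod_act unit M) M (tens_unitl M)
       (@rmod_act_unit_heq M)) _ _ _ _ _.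
Next Obligation. by move=> X M; apply: rmod_hom_eq; exact: tensm_id. Qed.
Next Obligation. by move=> *; apply: rmod_hom_eq; exact: tensm_comp. Qed.
Next Obligation. by move=> *; apply: rmod_hom_eq; exact: asc'_nat. Qed.
Next Obligation. by move=> M M' h; apply: rmod_hom_eq; exact: tensm_unitl. Qed.
Next Obligation.
move=> X Y Z M; apply: rmod_hom_eq => /=.
rewrite /asc tensm_eq_homl tensm_eq_homr !eq_hom_comp; exact: eq_hom_irr.
Qed.
Next Obligation.
move=> X M; apply: rmod_hom_eq => /=.
rewrite /unl tensm_eq_homl eq_hom_comp; exact: eq_hom_irr.
Qed.
Next Obligation.
move=> X M; apply: rmod_hom_eq => /=.
rewrite /unr tensm_eq_homl tensm_eq_homr eq_hom_comp; exact: eq_hom_irr.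
Qed.

End RightModules.

(* Main.v *)
(** A [C]-module transformation [f : Z ∗ - -> Id] on right [A]-modules and a map
    [ζ : Z -> A] that commutes with [A] determine each other: [ζ] is [f_A]
    evaluated at the unit of [A], and [f_M] is the composite of the half-braiding
    [Z ⊗ M -> M ⊗ Z], of [M ⊗ ζ] and of the action of [A] on [M]. Neither passage
    changes the object [Z] of the monoidal centre or its morphisms, and a tensor
    product [(Z, f) ⊗ (W, g)] corresponds to [mul (ζ ⊗ ω)]. So the two categories
    have the same terminal objects, and terminality identifies the algebra
    structures. *)
From Stdlib Require Import ssreflect.
Require Import Defs.

Set Implicit Arguments.
Unset Strict Implicit.
Unset Printing Implicit Defensive.
Local Open Scope cat_scope.

Section CentreOfModules.
Variables (C : StrictMonoidalCategory) (A : Algebra C).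

(** * Free right modules and the unit of [A] *)

Definition insert_one (X : C) : Hom X (X ⊗ A) := (idm X ⊠ one A) ∘ unr' X.

Lemma insert_one_nat (X Y : C) (f : Hom X Y) :
  insert_one Y ∘ f = (f ⊠ idm A) ∘ insert_one X.
Proof.
rewrite /insert_one comp_assoc -tensm_split (tensm_split' f) -!comp_assoc.
congr (_ ∘ _); apply: heq_eq; apply: heq_castl; apply: heq_sym.
by apply: heq_castr; exact: heq_unitr.
Qed.

Lemma insert_one_tens (X Y : C) :
  asc X Y A ∘ insert_one (X ⊗ Y) = idm X ⊠ insert_one Y.
Proof.
rewrite /insert_one -tensm_id comp_assoc asc_nat tensm_compr -comp_assoc.
by congr (_ ∘ _); rewrite /asc /unr' tensm_eq_homr eq_hom_comp; exact: eq_hom_irr.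
Qed.

Lemma rm_act_insert_one (M : rmod A) : rm_act M ∘ insert_one (rm_ob M) = idm (rm_ob M).
Proof. by rewrite /insert_one comp_assoc rm_one /unr /unr' eq_hom_comp eq_hom_id. Qed.

Definition regular_rmod : rmod A := MkRmod (mul_assoc A) (mul_oner A).

Lemma mul_insert_one : mul A ∘ insert_one A = idm (alg_ob A).
Proof. exact: (rm_act_insert_one regular_rmod). Qed.

(** With [rm_act_insert_one], this gives the triangle identities of the free-forgetful adjunction,
    whose unit is [insert_one] and whose counit is [rm_act_hom]. *)
Lemma mul_insert_one_left (X : C) :
  (idm X ⊠ mul A) ∘ asc X A A ∘ (insert_one X ⊠ idm A) = idm (X ⊗ A).
Proof.
rewrite /insert_one tensm_compl -!comp_assoc (comp_assoc (asc _ _ _)) asc_nat.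
rewrite !comp_assoc -tensm_compr mul_onel /unl /asc /unr'.
by rewrite tensm_eq_homr tensm_eq_homl !eq_hom_comp eq_hom_id.
Qed.

Definition rm_act_hom (M : rmod A) :
  rmod_hom (rmod_act (rm_ob M) regular_rmod) M :=
  @MkRmodHom C A (rmod_act (rm_ob M) regular_rmod) M (rm_act M)
    (eq_trans (rm_mul M) (eq_sym (comp_assoc _ _ _))).

Lemma unl_insert_one : unl A ∘ insert_one unit = one A.
Proof.
rewrite /insert_one /unl /unr' comp_assoc tensm_unitl -comp_assoc.
by rewrite eq_hom_comp eq_hom_id comp_idr.
Qed.

(** * From transformations to maps into [A] *)

Section ToFullCentre.
Variable P : comma_ob (centre_act (rmod_mc A)).
Let Z := comma_base P.

Definition comma_comp_at (M : rmod A) : Hom (cob Z ⊗ rm_ob M) (rm_ob M) :=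
  rm_hom (nt (comma_map P) M).

Local Notation f := comma_comp_at.

Lemma comma_comp_act (M : rmod A) :
  rm_act M ∘ (f M ⊠ idm A) = f M ∘ (idm (cob Z) ⊠ rm_act M) ∘ asc (cob Z) (rm_ob M) A.
Proof. by rewrite -comp_assoc; exact: (rm_hom_act (nt (comma_map P) M)). Qed.

Lemma comma_comp_nat (M N : rmod A) (g : rmod_hom M N) :
  f N ∘ (idm (cob Z) ⊠ g) = g ∘ f M.
Proof. exact: (f_equal (@rm_hom _ _ _ _) (nt_nat (comma_map P) g)). Qed.

Lemma comma_comp_mod (X : C) (M : rmod A) :
  f (rmod_act X M) = (idm X ⊠ f M) ∘ asc X (cob Z) (rm_ob M)
    ∘ (hbr Z X ⊠ idm (rm_ob M)) ∘ asc' (cob Z) X (rm_ob M).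
Proof.
have := f_equal (@rm_hom _ _ _ _) (nt_mod (comma_map P) X M).
rewrite /= comp_idl => E; apply: (eq_trans E).
(* The associator of [rmod_mc] is a cast along [eq_sym] of [tens_assoc], so its inverse carries a
   double [eq_sym]. *)
by rewrite !comp_assoc /asc (eq_hom_irr (eq_sym (eq_sym _)) (tens_assoc _ _ _)).
Qed.

Definition comma_fc_map : Hom (cob Z) A := f regular_rmod ∘ insert_one (cob Z).

(** A module map out of the free module on [Z] is recovered from its restriction to [Z]. *)
Lemma comma_comp_regular : mul A ∘ (comma_fc_map ⊠ idm A) = f regular_rmod.
Proof.
rewrite /comma_fc_map tensm_compl comp_assoc (comma_comp_act regular_rmod) /=.
by rewrite -!comp_assoc (comp_assoc (idm _ ⊠ _)) mul_insert_one_left comp_idr.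
Qed.

(** Once the identity of [M] is written as [rm_act M] after [insert_one], naturality at
    [rm_act_hom M] passes to the free module on [M], where [comma_comp_mod] reduces [f] to its value
    at [A]. *)
Lemma comma_compE (M : rmod A) :
  f M = rm_act M ∘ (idm (rm_ob M) ⊠ comma_fc_map) ∘ hbr Z (rm_ob M).
Proof.
rewrite -[LHS]comp_idr -tensm_id -[in LHS](rm_act_insert_one M) tensm_compr comp_assoc.
rewrite (comma_comp_nat (rm_act_hom M)) comma_comp_mod /= -!comp_assoc.
congr (_ ∘ _); rewrite -insert_one_tens (comp_assoc (asc' _ _ _)) asc'_asc comp_idl.
rewrite -insert_one_nat (comp_assoc (asc _ _ _)) insert_one_tens comp_assoc.
by rewrite -tensm_compr.
Qed.

(** The two sides of [fc_comm] are two computations of [f] at the regular module: by linearity and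
    by [comma_compE]. *)
Definition fc_of_comma : fc_ob A :=
  @MkFcOb C A Z comma_fc_map (eq_trans comma_comp_regular (comma_compE regular_rmod)).

End ToFullCentre.

(** * From maps into [A] to transformations *)

Section ToComma.
Variable P : fc_ob A.
Let Z := fc_centre P.

Definition fc_comp_at (M : rmod A) : Hom (cob Z ⊗ rm_ob M) (rm_ob M) :=
  rm_act M ∘ (idm (rm_ob M) ⊠ fc_map P) ∘ hbr Z (rm_ob M).

Lemma fc_comp_nat (M N : rmod A) (g : rmod_hom M N) :
  fc_comp_at N ∘ (idm (cob Z) ⊠ g) = g ∘ fc_comp_at M.
Proof.
rewrite /fc_comp_at -comp_assoc hbr_nat !comp_assoc -(comp_assoc (rm_act N)).
by rewrite -tensm_split' tensm_split !comp_assoc rm_hom_act.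
Qed.

Lemma fc_comp_mod (X : C) (M : rmod A) :
  fc_comp_at (rmod_act X M) = (idm X ⊠ fc_comp_at M) ∘ asc X (cob Z) (rm_ob M)
    ∘ (hbr Z X ⊠ idm (rm_ob M)) ∘ asc' (cob Z) X (rm_ob M).
Proof.
rewrite /fc_comp_at /= hbr_tens !comp_assoc -tensm_id.
rewrite (pre2 (asc_nat _ _ _)) -(comp_assoc _ (asc _ _ _) (asc' _ _ _)) asc_asc'.
by rewrite comp_idr !tensm_compr.
Qed.

(* The half-braiding at [M ⊗ A] and [fc_comm] turn the action of [A] after [ζ]
   into the action of [A] before it. *)
Lemma fc_comp_act (M : rmod A) :
  rm_act M ∘ (fc_comp_at M ⊠ idm A) =
  fc_comp_at M ∘ (idm (cob Z) ⊠ rm_act M) ∘ asc (cob Z) (rm_ob M) A.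
Proof.
rewrite (fc_comp_nat (rm_act_hom M)) fc_comp_mod /= {2}/fc_comp_at /=.
rewrite -fc_comm tensm_compr !comp_assoc (pre0 (asc'_asc _ _ _)).
rewrite -(comp_assoc _ _ (asc _ _ _)) -asc_nat comp_assoc -rm_mul.
by rewrite /fc_comp_at !tensm_compl !comp_assoc.
Qed.

Definition fc_comp_hom (M : rmod_mc A) : Hom (cob Z ∗ M) M :=
  @MkRmodHom C A (rmod_act (cob Z) M) M (fc_comp_at M)
    (eq_trans (fc_comp_act M) (eq_sym (comp_assoc _ _ _))).

Program Definition comma_of_fc : comma_ob (centre_act (rmod_mc A)) :=
  @MkCommaOb _ _ (centre_act (rmod_mc A)) Z
    (@MkMnat C (rmod_mc A) (centre_act_ob (rmod_mc A) Z) (mfun_id (rmod_mc A))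
       fc_comp_hom _ _).
Next Obligation. by move=> M N g; apply: rmod_hom_eq; exact: fc_comp_nat. Qed.
Next Obligation.
move=> X M; apply: rmod_hom_eq => /=; rewrite comp_idl fc_comp_mod !comp_assoc.
by rewrite /asc (eq_hom_irr (eq_sym (eq_sym _)) (tens_assoc _ _ _)).
Qed.

(** By [fc_comm] the map into [A] acts from the left, so the inserted unit is absorbed on the
    right. *)
Lemma fc_map_comma_of_fc : comma_fc_map comma_of_fc = fc_map P.
Proof.
rewrite /comma_fc_map /comma_comp_at /= /fc_comp_at /= -fc_comm -comp_assoc.
by rewrite -insert_one_nat comp_assoc mul_insert_one comp_idl.
Qed.

End ToComma.

(** * Morphisms and tensor products under the correspondence *)

Lemma comma_fc_map_nat (P Q : comma_ob (centre_act (rmod_mc A))) (h : comma_hom P Q) :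
  comma_fc_map Q ∘ chom (comma_mor h) = comma_fc_map P.
Proof.
rewrite /comma_fc_map -comp_assoc insert_one_nat comp_assoc; congr (_ ∘ _).
exact: (f_equal (fun t : mnat (centre_act_ob _ (comma_base P)) (mfun_id (rmod_mc A)) =>
  rm_hom (nt t regular_rmod)) (comma_mor_map h)).
Qed.

(** By [comma_compE] the map into [A] determines every component, so compatibility need only be
    checked there. *)
Lemma comma_map_of_fc_map (P Q : comma_ob (centre_act (rmod_mc A)))
    (h : Hom (comma_base P) (comma_base Q)) :
  comma_fc_map Q ∘ chom h = comma_fc_map P ->
  comma_map Q ∘ mf_mor (centre_act (rmod_mc A)) h = comma_map P.
Proof.
move=> E; apply: mnat_eq => M; apply: rmod_hom_eq.
apply: (eq_trans _ (eq_sym (comma_compE P M))); rewrite /= -/(comma_comp_at Q M).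
rewrite comma_compE -comp_assoc chom_hbr comp_assoc -(comp_assoc (rm_act M)).
by rewrite -tensm_compr E.
Qed.

(** [comma_comp_regular] turns multiplication by the first map into the component of [P] at [A];
    both sides then compose the components of [P] and [Q]. *)
Lemma comma_fc_map_tens (P Q : comma_ob (centre_act (rmod_mc A))) :
  comma_fc_map (comma_tens P Q) = mul A ∘ (comma_fc_map P ⊠ comma_fc_map Q).
Proof.
rewrite tensm_split comp_assoc comma_comp_regular {2}/comma_fc_map tensm_compr.
rewrite -insert_one_tens [RHS]comp_assoc [RHS]comp_assoc.
apply: (f_equal (fun k => k ∘ insert_one _)).
rewrite /comma_comp_at /= nt_unitl_id /= comp_idl /asc.
by rewrite (eq_hom_irr (eq_sym (eq_sym _)) (tens_assoc _ _ _)).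
Qed.

Lemma comma_fc_map_unit : comma_fc_map (comma_unit (centre_act (rmod_mc A))) = one A.
Proof.
exact: unl_insert_one.
Qed.

(** * Transfer of terminal objects *)

Program Definition full_centre_of_module_centre (S : ModuleCentre (rmod_mc A)) :
    FullCentre A :=
  @MkTerminal (fc_cat A) (fc_of_comma (term_ob S))
    (fun P => @MkFcHom C A P (fc_of_comma (term_ob S)) (comma_mor (bang S (comma_of_fc P))) _) _.
Next Obligation.
move=> S P; apply: eq_trans (fc_map_comma_of_fc P).
exact: (comma_fc_map_nat (bang S (comma_of_fc P))).
Qed.
Next Obligation.
move=> S P g; apply: fc_hom_eq => /=.
have E : comma_fc_map (term_ob S) ∘ chom (fc_chom g) = comma_fc_map (comma_of_fc P).
  by rewrite fc_map_comma_of_fc; exact: (fc_chom_map g).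
(* The same centre morphism, read in the comma category, where uniqueness is available. *)
pose h : comma_hom (comma_of_fc P) (term_ob S) :=
  @MkCommaHom _ _ _ (comma_of_fc P) (term_ob S) (fc_chom g)
    (@comma_map_of_fc_map (comma_of_fc P) (term_ob S) (fc_chom g) E).
exact: (f_equal (@comma_mor _ _ _ _ _) (bang_unique (t := S) h)).
Qed.

Program Definition module_centre_of_full_centre (T : FullCentre A) :
    ModuleCentre (rmod_mc A) :=
  @MkTerminal (comma_cat (centre_act (rmod_mc A))) (comma_of_fc (term_ob T))
    (fun P => @MkCommaHom _ _ _ P (comma_of_fc (term_ob T)) (fc_chom (bang T (fc_of_comma P)))
       (@comma_map_of_fc_map P (comma_of_fc (term_ob T)) _ _)) _.
Next Obligation.
move=> T P; rewrite fc_map_comma_of_fc.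
exact: (fc_chom_map (bang T (fc_of_comma P))).
Qed.
Next Obligation.
move=> T P g; apply: comma_hom_eq => /=.
have E : fc_map (term_ob T) ∘ chom (comma_mor g) = fc_map (fc_of_comma P).
  by rewrite -(fc_map_comma_of_fc (term_ob T)); exact: (comma_fc_map_nat g).
pose h : fc_hom (fc_of_comma P) (term_ob T) :=
  @MkFcHom C A (fc_of_comma P) (term_ob T) (comma_mor g) E.
exact: (f_equal (@fc_chom _ _ _ _) (bang_unique (t := T) h)).
Qed.

End CentreOfModules.

(** * Comparison of the algebra structures *)

Lemma full_centre_iso (C : StrictMonoidalCategory) (A : Algebra C) (S T : FullCentre A) :
  alg_isomorphic (full_centre_algebra S) (full_centre_algebra T).
Proof.
have hom (U V : FullCentre A) :
    @is_alg_hom _ (full_centre_algebra U) (full_centre_algebra V)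
      (fc_chom (bang V (term_ob U))).
  pose h : fc_hom (term_ob U) (term_ob V) := bang V (term_ob U); split.
    (* Both composites end in a terminal object of [fc_smc A], so they agree. *)
    have E : fc_comp h (bang U (fc_tens (term_ob U) (term_ob U))) =
        fc_comp (bang V (fc_tens (term_ob V) (term_ob V))) (fc_tensm h h).
      exact: (terminal_eq (D := fc_smc A) (T := V)).
    exact: (f_equal (@fc_chom _ _ _ _) E).
  have E : fc_comp h (bang U (fc_unit A)) = bang V (fc_unit A).
    exact: (terminal_eq (D := fc_smc A) (T := V)).
  exact: (f_equal (@fc_chom _ _ _ _) E).
have inv (U V : FullCentre A) :
    fc_chom (bang U (term_ob V)) ∘ fc_chom (bang V (term_ob U)) = idm _.
  have E : fc_comp (bang U (term_ob V)) (bang V (term_ob U)) = fc_idm (term_ob U).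
    exact: (terminal_eq (D := fc_smc A) (T := U)).
  exact: (f_equal (@fc_chom _ _ _ _) E).
exists (fc_chom (bang T (term_ob S))), (fc_chom (bang S (term_ob T))).
split; first exact: hom; split; first exact: hom.
by split; exact: inv.
Qed.

(** The object of the centre is the same on both sides, so equality follows from
    [full_centre_algebra_unique]: the structure maps on the left are comma morphisms, hence
    compatible with the map into [A]. *)
Lemma full_centre_of_module_centre_algebra (C : StrictMonoidalCategory)
    (A : Algebra C) (S : ModuleCentre (rmod_mc A)) :
  module_centre_algebra S = full_centre_algebra (full_centre_of_module_centre S).
Proof.
pose B := module_centre_algebra S.
apply: (@full_centre_algebra_unique C A (full_centre_of_module_centre S)
  (mul B) (one B) (mul_assoc B) (mul_onel B) (mul_oner B)); split => /=.
  rewrite -comma_fc_map_tens.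
  exact: (comma_fc_map_nat (bang S (comma_tens (term_ob S) (term_ob S)))).
rewrite -comma_fc_map_unit.
exact: (comma_fc_map_nat (bang S (comma_unit (centre_act (rmod_mc A))))).
Qed.

Theorem theorem6p2 (C : StrictMonoidalCategory) (A : Algebra C) :
  (inhabited (ModuleCentre (rmod_mc A)) <-> inhabited (FullCentre A)) /\
  (forall (S : ModuleCentre (rmod_mc A)) (T : FullCentre A),
     alg_isomorphic (module_centre_algebra S) (full_centre_algebra T)).
Proof.
split.
  split=> [[S]|[T]]; constructor; first exact: full_centre_of_module_centre S.
  exact: module_centre_of_full_centre T.
by move=> S T; rewrite full_centre_of_module_centre_algebra; exact: full_centre_iso.
Qed.
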